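(* Let $\mathcal A$ be a decorated algebra such that the operators $\underline E_\pm$ are locally nilpotent on $\mathcal A_\pm$. Then the map $\tau:=\eta_+\circ\sigma_-:\mathcal A_-\to\mathcal A_+$ is an isomorphism of algebras.
   Context: Let $\Bbbk=\mathbb Q(v^{1/2})$, $(n)_v=(v^n-v^{-n})/(v-v^{-1})$, $\langle1\rangle_v=v-v^{-1}$, and for an operator $X$ put $X^{(n)}=X^n/\prod_{s=1}^n(s)_v$. A decorated algebra is an associative (unital) $\mathbb Z$-graded $\Bbbk$-algebra $\mathcal A$ (degree of a homogeneous $x$ denoted $|x|$) with an element $E$, $|E|=2$, and mutually commuting locally nilpotent $\Bbbk$-linear endomorphisms $\underline F_+,\underline F_-$ of $\mathcal A$ of degree $-2$ with $\underline F_\pm(E)=1$ and $\underline F_\pm(xy)=v^{\pm\frac12|y|}\underline F_\pm(x)y+v^{\mp\frac12|x|}x\underline F_\pm(y)$ for homogeneous $x,y$. Put $\mathcal A_\pm=\ker\underline F_\mp$ (subalgebras, stable under $\underline F_\pm$) and $\mathcal A_0=\mathcal A_+\cap\mathcal A_-$. For homogeneous $x$ define $\underline K(x)=v^{|x|}x$ and $\underline E_\pm(x)=\mp\langle1\rangle_v^{-1}\big(v^{\pm\frac12|x|}Ex-v^{\mp\frac12|x|}xE\big)$, of degree $2$. Then $[\underline E_\pm,\underline F_\pm]=\langle1\rangle_v^{-1}(\underline K-\underline K^{-1})$, so $\underline E_\pm,\underline F_\pm,\underline K$ give two actions of $U_v(\mathfrak{sl}_2)$ (standard presentation) on $\mathcal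 A$, denoted $U_v(\mathfrak{sl}_2)_\pm$; $\mathcal A_\pm$ is a $U_v(\mathfrak{sl}_2)_\pm$-submodule, and $\mathcal A_0$ is the space of lowest weight vectors in each of $\mathcal A_+$, $\mathcal A_-$. Assume $\underline E_\pm$ is locally nilpotent on $\mathcal A_\pm$. Then $\mathcal A_\pm$ is a direct sum of finite dimensional $U_v(\mathfrak{sl}_2)_\pm$-modules and homogeneous nonzero $x\in\mathcal A_0$ have $|x|\le0$. The map $\sigma_-:\mathcal A_-\to\mathcal A_+$ is the unique isomorphism of $U_v(\mathfrak{sl}_2)$-modules (with $\mathcal A_\pm$ regarded as a $U_v(\mathfrak{sl}_2)_\pm$-module) that restricts to the identity on $\mathcal A_0$. The map $\eta_+:\mathcal A_+\to\mathcal A_+$ is the unique $\Bbbk$-linear involution with $\eta_+\underline E_+=\underline F_+\eta_+$, $\eta_+\underline F_+=\underline E_+\eta_+$, $\eta_+\underline K=\underline K^{-1}\eta_+$ and $\eta_+(x)=\underline E_+^{(-|x|)}(x)$ for homogeneous $x\in\mathcal A_0$. (Explicitly, $\tau(\underline E_-^{(r)}(z))=\underline E_+^{(-|z|-r)}(z)$ for homogeneous $z\in\mathcal A_0$, $0\le r\le-|z|$.) *)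

(* Defs.v *)
From HB Require Import structures.
From mathcomp Require Import all_boot all_order all_algebra.
From mathcomp Require Import boolp classical_sets functions cardinality fsbigop.
Set Implicit Arguments.
Unset Strict Implicit.
Unset Printing Implicit Defensive.
Import Order.TTheory GRing.Theory Num.Theory.
Local Open Scope classical_set_scope.
Local Open Scope ring_scope.

(* The field Q(v^{1/2}); vhalf is v^{1/2}, so v^{d/2} is written vhalf ^ d. *)
Definition kk : fieldType := {fraction {poly rat}}.
Definition vhalf : kk := tofrac 'X.
Definition v : kk := vhalf ^+ 2.
Definition angle1 : kk := v - v^-1.
Definition qint (n : nat) : kk := (v ^+ n - v ^- n) / (v - v^-1).

Definition locally_nilpotent (V : nmodType) (X : V -> V) : Prop :=
  forall x : V, exists n : nat, iter n X x = 0.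

Definition divpow (V : lmodType kk) (X : V -> V) (n : nat) (x : V) : V :=
  (\prod_(1 <= s < n.+1) qint s)^-1 *: iter n X x.

Record Zgrading (A : algType kk) := {
  hom :> int -> set A;
  hom0 : forall d, hom d 0;
  homP : forall d (a : kk) x y, hom d x -> hom d y -> hom d (a *: x + y);
  hom1 : hom 0 1;
  homM : forall d e x y, hom d x -> hom e y -> hom (d + e) (x * y);
  hom_direct_sum : forall x : A, exists! f : int -> A,
    [/\ finite_set [set d | f d != 0],
        forall d, hom d (f d) & x = \sum_(d \in [set: int]) f d] }.

Definition hcomp (A : algType kk) (G : Zgrading A) (x : A) : int -> A :=
  projT1 (cid (hom_direct_sum G x)).

(* With t = v^{1/2} this is the product rule of F_+, with t = v^{-1/2} that of
   F_-. *)
Definition twisted_derivation (A : algType kk) (G : Zgrading A) (t : kk)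
    (F : A -> A) : Prop :=
  forall d e x y, G d x -> G e y ->
    F (x * y) = t ^ e *: (F x * y) + t ^ (- d) *: (x * F y).

Record decoration (A : algType kk) := {
  dgr : Zgrading A;
  dE : A;
  dFp : {linear A -> A};
  dFm : {linear A -> A};
  dE_deg : dgr 2 dE;
  dFp_deg : forall d x, dgr d x -> dgr (d - 2) (dFp x);
  dFm_deg : forall d x, dgr d x -> dgr (d - 2) (dFm x);
  dFp_nil : locally_nilpotent dFp;
  dFm_nil : locally_nilpotent dFm;
  dF_comm : forall x, dFp (dFm x) = dFm (dFp x);
  dFpE : dFp dE = 1;
  dFmE : dFm dE = 1;
  dFpM : twisted_derivation dgr vhalf dFp;
  dFmM : twisted_derivation dgr vhalf^-1 dFm }.

Section Operators.
Variables (A : algType kk) (D : decoration A).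

(* These operators are given on homogeneous elements and extended linearly;
   all the sums have finite support. *)
Definition Kpow (t : kk) (x : A) : A :=
  \sum_(d \in [set: int]) t ^ d *: hcomp (dgr D) x d.
Definition dK : A -> A := Kpow v.
Definition dKinv : A -> A := Kpow v^-1.

Definition twisted_commE (t : kk) (x : A) : A :=
  \sum_(d \in [set: int])
     (t ^ d *: (dE D * hcomp (dgr D) x d)
      - t ^ (- d) *: (hcomp (dgr D) x d * dE D)).
Definition dEp (x : A) : A := - (angle1^-1 *: twisted_commE vhalf x).
Definition dEm (x : A) : A := angle1^-1 *: twisted_commE vhalf^-1 x.

Definition kerFm : {pred A} := [pred x | dFm D x == 0].
Definition kerFp : {pred A} := [pred x | dFp D x == 0].

Definition A0 : set A := [set x | dFp D x = 0 /\ dFm D x = 0].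

End Operators.

Section Closure.
Variables (A : algType kk) (G : Zgrading A).

Lemma hcompP x : [/\ finite_set [set d | hcomp G x d != 0],
  forall d, G d (hcomp G x d) & x = \sum_(d \in [set: int]) hcomp G x d].
Proof. by rewrite /hcomp; case: cid => f []. Qed.

Lemma hcomp_unique x f : finite_set [set d | f d != 0] ->
  (forall d, G d (f d)) -> x = \sum_(d \in [set: int]) f d -> hcomp G x = f.
Proof. by move=> h1 h2 h3; rewrite /hcomp; case: cid => g /= [_]; apply. Qed.

Lemma fsum_seq (f : int -> A) : finite_set [set d | f d != 0] ->
  exists s : seq int, forall phi : int -> A, (forall d, f d = 0 -> phi d = 0) ->
    \sum_(d \in [set: int]) phi d = \sum_(d <- s) phi d.
Proof.
move=> ff; exists (finmap.enum_fset (fset_set [set d | f d != 0])) => phi phi0.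
rewrite (@fsbigTE _ _ _ _ (fset_set [set d | f d != 0])) // => d.
by rewrite in_fset_set // notin_setE /= => /negP; rewrite negbK => /eqP /phi0.
Qed.

Lemma hcomp_seq x : exists s : seq int,
  forall phi : int -> A, (forall d, hcomp G x d = 0 -> phi d = 0) ->
    \sum_(d \in [set: int]) phi d = \sum_(d <- s) phi d.
Proof. by apply: fsum_seq; case: (hcompP x). Qed.

Lemma hcomp_linear_deg (F : {linear A -> A}) (k : int) x :
  (forall d y, G d y -> G (d + k) (F y)) ->
  forall d, hcomp G (F x) (d + k) = F (hcomp G x d).
Proof.
move=> Fdeg; have [fin hG xE] := hcompP x.
suff -> : hcomp G (F x) = fun d => F (hcomp G x (d - k)).
  by move=> d; rewrite addrK.
have fin' : finite_set [set d | F (hcomp G x (d - k)) != 0].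
  apply: sub_finite_set (finite_image (fun d => d + k) fin) => d /= Fd.
  exists (d - k); last by rewrite subrK.
  by apply: contraNneq Fd => ->; rewrite linear0.
apply: hcomp_unique => //.
  by move=> d; rewrite -{1}(subrK k d); apply: Fdeg.
have shift : \sum_(d \in [set: int]) F (hcomp G x d) =
   \sum_(d \in [set: int]) F (hcomp G x (d - k)).
  rewrite (@reindex_fsbigT _ _ _ _ _ (fun d : int => d - k)) //.
  by exists (fun d : int => d + k) => d; rewrite ?subrK ?addrK.
rewrite -shift {1}xE; have [s sP] := hcomp_seq x.
rewrite sP // sP ?linear_sum // => d ->; exact: linear0.
Qed.

Lemma hcomp_ker (F : {linear A -> A}) (k : int) x :
  (forall d y, G d y -> G (d + k) (F y)) -> F x = 0 ->
  forall d, F (hcomp G x d) = 0.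
Proof.
move=> Fdeg Fx0 d; rewrite -(hcomp_linear_deg _ Fdeg) Fx0.
rewrite (@hcomp_unique 0 (fun=> 0)) //; last by rewrite fsbig1.
  by rewrite (_ : [set _ | _] = set0) // -subset0 => e /=; rewrite eqxx.
by move=> e; apply: hom0.
Qed.

Lemma vhalf_neq0 : vhalf != 0.
Proof. by rewrite tofrac_eq0 polyX_eq0. Qed.

Lemma twisted_derivation1 t F : twisted_derivation G t F -> F 1 = 0.
Proof.
move=> FM; have := FM _ _ _ _ (hom1 G) (hom1 G).
by rewrite oppr0 expr0z !scale1r !mulr1 mul1r -{1}[F 1]addr0 => /addrI.
Qed.

Lemma ker_mul t (F : {linear A -> A}) k x y : twisted_derivation G t F ->
  (forall d z, G d z -> G (d + k) (F z)) -> F x = 0 -> F y = 0 -> F (x * y) = 0.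
Proof.
move=> FM Fdeg Fx Fy.
have [_ hx xE] := hcompP x; have [_ hy yE] := hcompP y.
have [s sP] := hcomp_seq x; have [r rP] := hcomp_seq y.
rewrite xE yE sP // rP // mulr_suml linear_sum big1 // => d _.
rewrite mulr_sumr linear_sum big1 // => e _.
rewrite (FM _ _ _ _ (hx d) (hy e)) (hcomp_ker Fdeg Fx) (hcomp_ker Fdeg Fy).
by rewrite mul0r mulr0 !scaler0 addr0.
Qed.

Lemma ker_lin (F : {linear A -> A}) a x y :
  F x = 0 -> F y = 0 -> F (a *: x + y) = 0.
Proof. by move=> Fx Fy; rewrite linearP Fx Fy scaler0 addr0. Qed.

End Closure.

Section Subalgebras.
Variables (A : algType kk) (D : decoration A).

Lemma kerFm_subalg : subalg_closed (kerFm D).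
Proof.
split=> [|a x y|x y]; rewrite !inE.
- by rewrite (twisted_derivation1 (@dFmM _ D)).
- by move=> /eqP hx /eqP hy; rewrite (ker_lin _ hx hy).
by move=> /eqP hx /eqP hy; rewrite (ker_mul (@dFmM _ D) (@dFm_deg _ D) hx hy).
Qed.

Lemma kerFp_subalg : subalg_closed (kerFp D).
Proof.
split=> [|a x y|x y]; rewrite !inE.
- by rewrite (twisted_derivation1 (@dFpM _ D)).
- by move=> /eqP hx /eqP hy; rewrite (ker_lin _ hx hy).
by move=> /eqP hx /eqP hy; rewrite (ker_mul (@dFpM _ D) (@dFp_deg _ D) hx hy).
Qed.

HB.instance Definition _ := GRing.isSubalgClosed.Build kk A (kerFm D) kerFm_subalg.
HB.instance Definition _ := GRing.isSubalgClosed.Build kk A (kerFp D) kerFp_subalg.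

Record Aplus := MkAplus { plus_val : A; plus_valP : plus_val \in kerFm D }.
HB.instance Definition _ := [isSub for plus_val].
HB.instance Definition _ := [Choice of Aplus by <:].
HB.instance Definition _ := [SubChoice_isSubAlgebra of Aplus by <:].

Record Aminus := MkAminus { minus_val : A; minus_valP : minus_val \in kerFp D }.
HB.instance Definition _ := [isSub for minus_val].
HB.instance Definition _ := [Choice of Aminus by <:].
HB.instance Definition _ := [SubChoice_isSubAlgebra of Aminus by <:].

Lemma Kpow_ker t (F : {linear A -> A}) :
  (forall d z, dgr D d z -> dgr D (d - 2) (F z)) ->
  forall x, F x = 0 -> F (Kpow D t x) = 0.
Proof.
move=> Fdeg x Fx; have [s sP] := hcomp_seq (dgr D) x.
rewrite /Kpow sP; last by move=> d ->; rewrite scaler0.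
rewrite linear_sum big1 // => d _.
by rewrite linearZ /= (hcomp_ker Fdeg Fx) scaler0.
Qed.

Lemma twisted_commE_ker t (F : {linear A -> A}) : t != 0 ->
  twisted_derivation (dgr D) t^-1 F -> F (dE D) = 1 ->
  (forall d z, dgr D d z -> dgr D (d - 2) (F z)) ->
  forall x, F x = 0 -> F (twisted_commE D t x) = 0.
Proof.
move=> t0 FM FE Fdeg x Fx; have [s sP] := hcomp_seq (dgr D) x.
have [_ hx _] := hcompP (dgr D) x.
rewrite /twisted_commE sP; last by move=> d ->; rewrite mul0r mulr0 !scaler0 subrr.
rewrite linear_sum big1 // => d _.
rewrite linearB !linearZ /= (FM _ _ _ _ (@dE_deg _ D) (hx d)).
rewrite (FM _ _ _ _ (hx d) (@dE_deg _ D)) (hcomp_ker Fdeg Fx) FE.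
rewrite mul0r mulr0 !scaler0 addr0 add0r mul1r mulr1 !scalerA.
by rewrite scalerN !exprz_inv !opprK scalerA -!expfzDr // subrr addNr subrr.
Qed.

Lemma dFp_plus_subproof (x : Aplus) : dFp D (val x) \in kerFm D.
Proof. by case: x => x /= /eqP hx; rewrite inE -dF_comm hx linear0. Qed.
Definition Fplus (x : Aplus) : Aplus := MkAplus (dFp_plus_subproof x).

Lemma dEp_plus_subproof (x : Aplus) : dEp D (val x) \in kerFm D.
Proof.
case: x => x /= /eqP hx; rewrite inE /dEp linearN linearZ /=.
rewrite twisted_commE_ker ?scaler0 ?oppr0 ?vhalf_neq0 ?dFmE //.
- exact: dFmM.
exact: dFm_deg.
Qed.
Definition Eplus (x : Aplus) : Aplus := MkAplus (dEp_plus_subproof x).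

Lemma dK_plus_subproof (x : Aplus) : dK D (val x) \in kerFm D.
Proof. by case: x => x /= /eqP hx; rewrite inE Kpow_ker //; exact: dFm_deg. Qed.
Definition Kplus (x : Aplus) : Aplus := MkAplus (dK_plus_subproof x).

Lemma dKinv_plus_subproof (x : Aplus) : dKinv D (val x) \in kerFm D.
Proof. by case: x => x /= /eqP hx; rewrite inE Kpow_ker //; exact: dFm_deg. Qed.
Definition Kinvplus (x : Aplus) : Aplus := MkAplus (dKinv_plus_subproof x).

Lemma dFm_minus_subproof (x : Aminus) : dFm D (val x) \in kerFp D.
Proof. by case: x => x /= /eqP hx; rewrite inE dF_comm hx linear0. Qed.
Definition Fminus (x : Aminus) : Aminus := MkAminus (dFm_minus_subproof x).

Lemma dEm_minus_subproof (x : Aminus) : dEm D (val x) \in kerFp D.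
Proof.
case: x => x /= /eqP hx; rewrite inE /dEm linearZ /=.
rewrite twisted_commE_ker ?scaler0 ?invr_eq0 ?vhalf_neq0 ?dFpE //.
- by rewrite invrK; exact: dFpM.
exact: dFp_deg.
Qed.
Definition Eminus (x : Aminus) : Aminus := MkAminus (dEm_minus_subproof x).

Lemma dK_minus_subproof (x : Aminus) : dK D (val x) \in kerFp D.
Proof. by case: x => x /= /eqP hx; rewrite inE Kpow_ker //; exact: dFp_deg. Qed.
Definition Kminus (x : Aminus) : Aminus := MkAminus (dK_minus_subproof x).

Definition is_sigma_minus (s : Aminus -> Aplus) : Prop :=
  [/\ linear s /\ bijective s,
      forall x, s (Eminus x) = Eplus (s x),
      forall x, s (Fminus x) = Fplus (s x),
      forall x, s (Kminus x) = Kplus (s x) &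
      forall x, A0 D (val x) -> val (s x) = val x].

(* In the last clause x has degree - n; nonzero homogeneous elements of A_0
   have degree <= 0, so no case is left out. *)
Definition is_eta_plus (h : Aplus -> Aplus) : Prop :=
  [/\ linear h /\ involutive h,
      forall x, h (Eplus x) = Fplus (h x),
      forall x, h (Fplus x) = Eplus (h x),
      forall x, h (Kplus x) = Kinvplus (h x) &
      forall (n : nat) (x : Aplus), A0 D (val x) -> dgr D (- n%:Z) (val x) ->
        h x = divpow Eplus n x].

(* "The unique map such that ...": xget P picks a map satisfying P; its default
   value 0 is only taken when there is none. *)
Definition sigma_minus : Aminus -> Aplus := xget (fun=> 0) is_sigma_minus.
Definition eta_plus : Aplus -> Aplus := xget (fun=> 0) is_eta_plus.

Definition tau : Aminus -> Aplus := eta_plus \o sigma_minus.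

End Subalgebras.

Definition algebra_isomorphism (R : nzRingType) (B C : algType R)
    (f : B -> C) : Prop :=
  [/\ linear f, monoid_morphism f & bijective f].

(* Main.v *)
Require Import Defs.
From mathcomp Require Import all_boot all_order all_algebra.
From HB Require Import structures.
From mathcomp Require Import boolp classical_sets functions cardinality fsbigop.
From mathcomp Require Import finmap zify ring.

Set Implicit Arguments.
Unset Strict Implicit.
Unset Printing Implicit Defensive.

Import Order.TTheory GRing.Theory Num.Theory.

Local Open Scope classical_set_scope.
Local Open Scope ring_scope.

(* Idea. The operator y |-> v^{(|y|-2b)/2} E y - v^{(2b-|y|)/2} y E, suitably
   normalised, extends E_+ (the case b = 0) to ker F_-^{b+1}, which it makes
   into an sl2-module for F_+ with weights |y| - b, still with locally nilpotent
   raising operator.  Call u in A_- and w in A_+ linked in bidegree (p, q) when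
   some Y of degree p + q with F_+^{p+1} Y = 0 = F_-^{q+1} Y satisfies
   F_+^{(p)} Y = u and F_-^{(q)} Y = w.
   - Links multiply: only the top terms of the q-Leibniz formulas for
     F_+^{(p+p')} (Y Y') and F_-^{(q+q')} (Y Y') survive, and the two powers of v
     they carry agree.  Multiplying Y by E turns a (p, q)-link into a
     (p+1, q+1)-link.
   - u determines w: if u = 0, then Y has weight p in the sl2-module ker F_-^{q+1}
     and is killed by F_+^p, so Y = 0.
   - If z in A_0 has degree -(p+q), then E_-^{(q)} z and E_+^{(p)} z are linked,
     through a Y that is a product of p + q commuting raising operators applied
     to z.
   Hence every u in A_- is linked to tau u, and tau is multiplicative.  The maps
   sigma_- and eta_+ exist because an integrable sl2-module is the direct sum of
   its strings E^r z, so linear maps can be prescribed on strings. *)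

(** * Quantum integers *)

Section QuantumIntegers.
Variables (K : fieldType) (q : K).
Hypothesis q0 : q != 0.

Definition qz (d : int) : K := (q ^ d - q ^ (- d)) / (q - q^-1).

Lemma qzN d : qz (- d) = - qz d.
Proof. by rewrite /qz opprK -mulNr opprB. Qed.

Lemma qzD i j : qz (i + j) = q ^ j * qz i + q ^ (- i) * qz j.
Proof.
rewrite /qz !opprD !expfzDr // -!invr_expz; set a := q ^ i; set b := q ^ j.
have a0 : a != 0 by rewrite expfz_neq0.
have b0 : b != 0 by rewrite expfz_neq0.
rewrite !mulrA -mulrDl; congr (_ / _); ring.
Qed.

Hypothesis q1 : q - q^-1 != 0.

Lemma qz1 : qz 1 = 1.
Proof. by rewrite /qz expr1z -invr_expz expr1z divff. Qed.

(** Commuting E past a power of F, or F past a power of E, yields a coefficient that is a product of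
    two quantum integers; this identity is the inductive step for it in [iterF_E] and [F_string]. *)
Lemma qzM_shift (k d : int) :
  qz k * qz (d - k + 1) + qz (d - k - k) = qz (k + 1) * qz (d - k).
Proof.
rewrite /qz !opprD !opprK !expfzDr // -!invr_expz !expr1z.
set a := q ^ k; set b := q ^ d.
have a0 : a != 0 by rewrite expfz_neq0.
have b0 : b != 0 by rewrite expfz_neq0.
have qq : q * q - 1 = q * (q - q^-1) by rewrite mulrBr divff.
by field; rewrite qq !mulf_neq0 ?q0 ?q1 ?a0 ?b0.
Qed.

End QuantumIntegers.

Lemma cancel_middle (K : fieldType) (a b c d : K) : b != 0 ->
  a / (b * c) * (b * d) = d * a / c.
Proof. by move=> b0; rewrite invfM; move: c^-1 => c'; field. Qed.

(** The polynomials X^n and 1 have different degrees. Hence v is not a root of unity and all quantum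
    factorials are invertible. *)
Lemma vhalfX_neq1 n : (0 < n)%N -> vhalf ^+ n != 1.
Proof.
move=> n0; rewrite /vhalf -tofracXn -tofrac1 tofrac_eq.
by apply/eqP => /(congr1 (size \o val))/=; rewrite size_polyXn size_poly1; lia.
Qed.

Lemma v_neq0 : v != 0.
Proof. by rewrite expf_neq0 ?vhalf_neq0. Qed.

Lemma vz_neq0 (d : int) : d != 0 -> v ^ d - v ^ (- d) != 0.
Proof.
move=> d0; rewrite subr_eq0.
wlog [n -> n0] : d d0 / exists2 n : nat, d = n & (0 < n)%N.
  move=> th; case: d d0 => n n0; first by apply: th => //; exists n => //; lia.
  by rewrite NegzE opprK eq_sym; apply: (th n.+1) => //; exists n.+1.
apply/eqP => /(congr1 ( *%R (v ^ n)));
  rewrite -!expfzDr ?v_neq0 // subrr expr0z.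
move/eqP; apply/negP; rewrite -PoszD -exprnP /v -exprM; apply: vhalfX_neq1; lia.
Qed.

Lemma v_sub_neq0 : v - v^-1 != 0.
Proof. by have := @vz_neq0 1 isT; rewrite expr1z -invr_expz expr1z. Qed.

Local Notation qv := (qz v).

Lemma qv_neq0 (d : int) : d != 0 -> qv d != 0.
Proof. by move=> d0; rewrite mulf_neq0 ?vz_neq0 // invr_eq0 v_sub_neq0. Qed.

Lemma qintE n : qint n = qv n.
Proof. by rewrite /qint /qz -invr_expz. Qed.

Definition qfact (n : nat) : kk := \prod_(1 <= s < n.+1) qint s.

Lemma qfact0 : qfact 0 = 1.
Proof. by rewrite /qfact big_geq. Qed.

Lemma qfactS n : qfact n.+1 = qv n.+1 * qfact n.
Proof. by rewrite /qfact big_nat_recr //= mulrC qintE. Qed.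

Lemma qfact_neq0 n : qfact n != 0.
Proof.
elim: n => [|n IH]; first by rewrite qfact0 oner_neq0.
by rewrite qfactS mulf_neq0 ?qv_neq0.
Qed.

(** * Weight modules for quantum sl2 *)

Section IterLinear.
Variables (R : nzRingType) (V : lmodType R) (f : {linear V -> V}) (n : nat).

Lemma iter_is_linear : linear (iter n f).
Proof. by elim: n => [//|k IH] a x y; rewrite !iterS IH linearP. Qed.

HB.instance Definition _ :=
  GRing.isLinear.Build R V V *:%R (iter n f) iter_is_linear.

End IterLinear.

Lemma iterZ (R : nzRingType) (V : lmodType R) (f : {linear V -> V}) n a x :
  iter n f (a *: x) = a *: iter n f x.
Proof. exact: (linearZ_LR (iter n f)). Qed.

Lemma iter_comm (T : Type) (f g : T -> T) m n x : (forall y, f (g y) =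
  g (f y)) ->
  iter m f (iter n g x) = iter n g (iter m f x).
Proof.
move=> fg; elim: m => //= m ->; elim: n => //= n IH; by rewrite fg IH.
Qed.

Lemma scalerI_eq (V : lmodType kk) (c : kk) (x y : V) : c != 0 -> c *: x =
  c *: y -> x = y.
Proof. by move=> c0 /(congr1 (GRing.scale c^-1));
  rewrite !scalerA (mulVf c0) !scale1r. Qed.

Lemma iter_le0 (R : nzRingType) (V : lmodType R) (f : {linear V -> V}) m n x :
  (m <= n)%N -> iter m f x = 0 -> iter n f x = 0.
Proof.
move=> /subnK <- fx; rewrite iterD fx.
by elim: (n - m)%N => //= k ->; rewrite linear0.
Qed.

(** K is encoded by the weight spaces [P d], on which it acts as v^d; [wtFE] is the commutator
    relation there. Weight spaces are predicates on an ambient space, so that a submodule such as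
    ker F_-^{b+1} can be treated with operators defined on the whole algebra. *)
Record sl2_weights (V : lmodType kk) (P : int -> V -> Prop)
    (E F : {linear V -> V}) : Prop := Sl2Weights {
  wt0 : forall d, P d 0;
  wtP : forall d a x y, P d x -> P d y -> P d (a *: x + y);
  wtE : forall d x, P d x -> P (d + 2) (E x);
  wtF : forall d x, P d x -> P (d - 2) (F x);
  wtFE : forall d x, P d x -> F (E x) = E (F x) - qv d *: x;
  wt_Enil : forall d x, P d x -> exists n, iter n E x = 0 }.

Section Sl2.
Variables (V : lmodType kk) (P : int -> V -> Prop) (E F : {linear V -> V}).
Hypothesis rep : sl2_weights P E F.

Lemma wtZ d a x : P d x -> P d (a *: x).
Proof. by move=> Px; rewrite -[_ *: _]addr0;
  apply: wtP rep _ _ _ _ Px (wt0 rep d). Qed.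

Lemma wtB d x y : P d x -> P d y -> P d (x - y).
Proof. by move=> Px Py; rewrite addrC -scaleN1r;
  apply: wtP rep _ _ _ _ Py Px. Qed.

Lemma wt_iterF d k x : P d x -> P (d - 2 *+ k) (iter k F x).
Proof.
move=> Px; elim: k => [|k IH]; first by rewrite subr0.
by rewrite iterS (_ : d - _ = d - 2 *+ k - 2); [apply: wtF rep _ _ IH|lia].
Qed.

Lemma wt_iterE d k x : P d x -> P (d + 2 *+ k) (iter k E x).
Proof.
move=> Px; elim: k => [|k IH]; first by rewrite addr0.
by rewrite iterS (_ : d + _ = d + 2 *+ k + 2); [apply: wtE rep _ _ IH|lia].
Qed.

Lemma iterF_E d k x : P d x ->
  iter k.+1 F (E x) = E (iter k.+1 F x) - (qv k.+1 * qv (d - k%:Z)) *: iter k F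
    x.
Proof.
move=> Px; elim: k => [|k IH].
  by rewrite /= (wtFE rep Px) (qz1 v_sub_neq0) mul1r subr0.
rewrite iterS IH linearB linearZ /= (wtFE rep (wt_iterF k.+1 Px)).
rewrite -addrA -opprD -scalerDl; congr (_ - _ *: _).
have := qzM_shift v_neq0 v_sub_neq0 k.+1 (d : int).
rewrite (_ : k.+1%:Z + 1 = k.+2%:Z) => [<-|]; last lia.
rewrite addrC.
by congr (_ * qv _ + qv _); lia.
Qed.

(* Apply E: the hypotheses pass from (x, m, d) to (E x, m + 1, d + 2), so
   nilpotency of E reduces to E x = 0, where F^m x = 0 forces x = 0. *)
Lemma sl2_inj d m x : P d x -> iter m F x = 0 -> m%:Z <= d -> x = 0.
Proof.
move=> Px; have [n] := wt_Enil rep Px.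
elim: n d m x Px => [//|n IH] d m x Px; rewrite iterSr => En Fm md.
have Ex0 : E x = 0.
  apply: IH (wtE rep Px) En (_ : iter m.+1 F (E x) = 0) _; last lia.
  by rewrite (iterF_E _ Px) iterS Fm !linear0 addr0.
elim: m Fm md => [//|m IHm] Fm md; apply: IHm; last lia.
have := iterF_E m Px; rewrite Fm Ex0 !linear0 sub0r => /esym/eqP.
rewrite oppr_eq0 scaler_eq0 mulf_eq0 => /orP[/orP[]|/eqP //].
  by rewrite (negPf (qv_neq0 _)).
by rewrite (negPf (qv_neq0 _)) //; lia.
Qed.

Definition lowest (n : nat) (z : V) : Prop := P (- n%:Z) z /\ F z = 0.

Lemma lowestP n a x y : lowest n x -> lowest n y -> lowest n (a *: x + y).
Proof.
move=> [Px Fx] [Py Fy]; split; first exact: wtP rep _ _ _ _ Px Py.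
by rewrite linearP Fx Fy scaler0 addr0.
Qed.

Lemma lowest0 n : lowest n 0.
Proof. by split; [apply: wt0 rep _|rewrite linear0]. Qed.

Lemma wt_string n r z : lowest n z -> P (2 *+ r - n%:Z) (iter r E z).
Proof. by move=> [Pz _]; rewrite addrC; apply: wt_iterE. Qed.

Lemma F_string n r z : lowest n z ->
  F (iter r.+1 E z) = (qv r.+1 * qv (n%:Z - r%:Z)) *: iter r E z.
Proof.
move=> lz; elim: r => [|r IH].
  case: lz => Pz Fz; rewrite /= (wtFE rep Pz) Fz linear0 sub0r subr0 qzN.
  by rewrite scaleNr opprK (qz1 v_sub_neq0) mul1r.
rewrite iterS (wtFE rep (wt_string r.+1 lz)) IH linearZ /= -scalerBl.
congr (_ *: _); have := qzM_shift v_neq0 v_sub_neq0 r.+1 n.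
rewrite (_ : r.+1%:Z + 1 = r.+2%:Z) => [<-|]; last lia.
rewrite -qzN.
by congr (_ * qv _ + qv _); lia.
Qed.

(** Iteration of [F_string]: F^r E^{p+r} z is E^p z times the quotient of [p+r]! [n-p]! by [p]!
    [n-p-r]!, with denominators cleared. *)
Lemma iterF_string n p r z : lowest n z -> (p + r <= n)%N ->
  (qfact p * qfact (n - p - r)) *: iter r F (iter (p + r) E z) =
  (qfact (p + r) * qfact (n - p)) *: iter p E z.
Proof.
move=> lz; elim: r => [|r IH] le_n; first by rewrite subn0 addn0 /= mulrC.
rewrite addnS iterSr (F_string _ lz) linearZ scalerA.
rewrite (_ : n%:Z - _ = (n - p - r.+1).+1%:Z); last lia.
have := IH ltac:(lia).
rewrite (_ : (n - p - r)%N = (n - p - r.+1).+1); last lia.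
rewrite !qfactS => IH'.
rewrite (_ : _ * _ = qv (p + r).+1 * (qfact p * (qv (n - p - r.+1).+1%:Z *
  qfact (n - p - r.+1)))); last ring.
by rewrite -scalerA IH' scalerA mulrA.
Qed.

Lemma iterF_string_full n r z : lowest n z -> (r <= n)%N ->
  iter r F (iter r E z) = (qfact r * qfact n / qfact (n - r)) *: z.
Proof.
move=> lz rn; have := @iterF_string n 0 r z lz rn.
rewrite qfact0 mul1r subn0 add0n => /(congr1 (GRing.scale (qfact (n - r))^-1)).
by rewrite !scalerA mulVf ?qfact_neq0 // scale1r mulrC.
Qed.

Lemma iterF_string0 n r k z : lowest n z -> (r < k)%N ->
  iter k F (iter r E z) = 0.
Proof.
move=> lz rk; apply: (@iter_le0 _ _ F r.+1) => //; elim: r {rk} => [|r IH].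
  by case: lz.
by rewrite iterSr (F_string _ lz) linearZ /= -iterS IH scaler0.
Qed.

(** The vector E^{n+1} z has weight n+2 and is killed by F^{n+2}, so [sl2_inj] applies. *)
Lemma iterE_string0 n z : lowest n z -> iter n.+1 E z = 0.
Proof.
move=> lz; apply: (@sl2_inj _ n.+2) (wt_string n.+1 lz) _ _; last lia.
exact: iterF_string0 lz _.
Qed.

(** Strings are peeled off from the top. If F^{m+1} x = 0, then F^m x is a lowest weight vector, and
    F^m E^m multiplies it by some c; subtracting c^-1 E^m F^m x from x leaves a vector killed by
    F^m. For d > m the vector x is 0 by [sl2_inj]; otherwise n = 2m - d is at least m, which makes c
    nonzero. *)
Lemma sl2_string_ind (Q : V -> Prop) d m :
    Q 0 -> (forall a x y, Q x -> Q y -> Q (a *: x + y)) ->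
    (forall n r z, (r < m)%N -> (r <= n)%N -> 2 *+ r - n%:Z = d ->
       lowest n z -> Q (iter r E z)) ->
  forall x, P d x -> iter m F x = 0 -> Q x.
Proof.
move=> Q0 QP; elim: m => [|m IH] Qg x Px Fx; first by rewrite (Fx : x = 0).
have [md|dm] := leP m.+1%:Z d; first by rewrite (sl2_inj Px Fx md).
have nE : - `|2 *+ m - d|%N%:Z = d - 2 *+ m by lia.
set n := `|2 *+ m - d|%N in nE.
have mn : (m <= n)%N by lia.
have lz : lowest n (iter m F x) by split; [rewrite nE; apply: wt_iterF|].
set c := qfact m * qfact n / qfact (n - m).
have c0 : c != 0 by rewrite !mulf_neq0 ?invr_eq0 ?qfact_neq0.
have Ez : P d (iter m E (iter m F x)).
  by rewrite (_ : d = 2 *+ m - n%:Z); [apply: wt_string|lia].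
rewrite -[x](subrK (c^-1 *: iter m E (iter m F x))) addrC; apply: QP.
  by apply: (Qg n) => //; lia.
apply: IH; first by move=> n' r z rm; apply: Qg; lia.
  by apply: wtB => //; apply: wtZ.
by rewrite linearB linearZ /= (iterF_string_full lz) // scalerA mulVf //
  scale1r subrr.
Qed.

End Sl2.

(** * Linear maps prescribed on strings *)

Section Sl2Lift.
Variables (V : lmodType kk) (P : int -> V -> Prop) (E F : {linear V -> V}).
Hypothesis rep : sl2_weights P E F.
Hypothesis Fnil : locally_nilpotent F.
Hypothesis gen : forall Q : V -> Prop, Q 0 ->
  (forall a x y, Q x -> Q y -> Q (a *: x + y)) ->
  (forall d x, P d x -> Q x) -> forall x, Q x.
Hypothesis indep : forall N (f : nat -> V), (forall n, P (- n%:Z) (f n)) ->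
  \sum_(0 <= n < N) f n = 0 -> forall n, (n < N)%N -> f n = 0.

Local Notation low := (lowest P F).

Lemma sl2_string_gen (Q : V -> Prop) :
    Q 0 -> (forall a x y, Q x -> Q y -> Q (a *: x + y)) ->
    (forall n r z, (r <= n)%N -> low n z -> Q (iter r E z)) ->
  forall x, Q x.
Proof.
move=> Q0 QP Qg; apply: gen => // d x Px; have [m Fx] := Fnil x.
by apply: (sl2_string_ind rep Q0 QP _ Px Fx) => n r z _ rn _; apply: Qg.
Qed.

(** The family [f n r] consists of lowest weight vectors of weight -n. With [h] equal to E^r the sum
    is an element of V, with [h] the prescribed values it is the image of that element: both are
    read off the same family. *)
Definition strings_sum (W : nmodType) (N : nat) (h : nat -> nat -> V -> W)
    (f : nat -> nat -> V) : W :=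
  \sum_(0 <= n < N) \sum_(0 <= r < n.+1) h n r (f n r).

Lemma strings_sum_widen (W : nmodType) N M (h : nat -> nat -> V -> W) f :
  (forall n r, h n r 0 = 0) -> (forall n r, (N <= n)%N -> f n r = 0) ->
  (N <= M)%N -> strings_sum M h f = strings_sum N h f.
Proof.
move=> h0 f0 NM; rewrite /strings_sum (@big_cat_nat _ _ _ N) //= [X in _ +
  X]big_nat.
by rewrite [X in _ + X]big1 ?addr0 // => n /andP[Nn _]; rewrite big1 // => r _;
  rewrite f0.
Qed.

(** Descending induction on the position R in the string: F^R kills the terms with r < R, those with
    r > R are already zero, and what remains are nonzero multiples of the [f n R], which lie in
    distinct weights -n and are therefore independent. *)
Lemma strings_sum_eq0 N f : (forall n r, low n (f n r)) ->
  strings_sum N (fun _ r => iter r E) f = 0 ->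
  forall n r, (n < N)%N -> (r <= n)%N -> f n r = 0.
Proof.
move=> lf sum0 n r nN rn.
suff th j n' r' : (n' < N)%N -> (r' <= n')%N -> (N - j <= r')%N -> f n' r' = 0.
  by apply: (th N) => //; rewrite subnn.
elim: j n' r' => [|j IH] n' R n'N Rn' NR; first by lia.
have [NjR|RNj] := leqP (N - j)%N R; first exact: IH.
pose c m := qfact R * qfact m / qfact (m - R).
pose g m := if (R <= m)%N then c m *: f m R else 0.
suff: g n' = 0.
  rewrite /g Rn' => /eqP; rewrite scaler_eq0 => /orP[|/eqP //].
  by rewrite !mulf_eq0 invr_eq0 !(negPf (qfact_neq0 _)).
apply: (indep (N := N)) => // [m|].
  rewrite /g; case: ifP => _; last exact: wt0 rep _.
  by apply: (wtZ rep); case: (lf m R).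
have := congr1 (iter R F) sum0; rewrite linear0 => {2}<-.
rewrite /strings_sum linear_sum; apply: eq_big_nat => m mN.
rewrite linear_sum /g; case: leqP => Rm.
  rewrite (bigD1_seq R) ?iota_uniq ?mem_index_iota //=.
  rewrite (iterF_string_full rep (lf _ _)) // big_nat_cond big1 ?addr0 // => i.
  case/andP=> /andP[_ im] iR; have [iR'|Ri] := ltnP i R.
    exact: (iterF_string0 rep (lf m i)).
  by rewrite IH ?linear0 //; lia.
rewrite big_nat_cond big1 // => i /andP[/andP[_ im] _].
by apply: (iterF_string0 rep (lf _ _)); lia.
Qed.

Section Lift.
Variables (W : lmodType kk) (g : nat -> nat -> V -> W).
Hypothesis g_lin : forall n r a x y, low n x -> low n y ->
  g n r (a *: x + y) = a *: g n r x + g n r y.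

Lemma lift_base0 n r : g n r 0 = 0.
Proof.
have l0 := lowest0 rep n; have := g_lin r 1 l0 l0.
by rewrite !scale1r addr0 -{1}[g n r 0]addr0 => /addrI.
Qed.

(** The graph of the map to be constructed. *)
Definition lift_rel (x : V) (y : W) : Prop := exists N f,
  [/\ forall n r, low n (f n r), forall n r, (N <= n)%N -> f n r = 0,
      x = strings_sum N (fun _ r => iter r E) f & y = strings_sum N g f].

Lemma lift_relP a x y x' y' : lift_rel x y -> lift_rel x' y' ->
  lift_rel (a *: x + x') (a *: y + y').
Proof.
move=> [N [f [lf f0 -> ->]]] [M [h [lh h0 -> ->]]].
have i0 (n r : nat) : iter r E 0 = 0 by rewrite linear0.
have NK : (N <= maxn N M)%N by lia.
have MK : (M <= maxn N M)%N by lia.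
rewrite -(strings_sum_widen i0 f0 NK) -(strings_sum_widen i0 h0 MK).
rewrite -(strings_sum_widen lift_base0 f0 NK) -(strings_sum_widen lift_base0 h0
  MK).
exists (maxn N M), (fun n r => a *: f n r + h n r); split.
- by move=> n r; apply: (lowestP rep).
- by move=> n r NMn; rewrite f0 ?h0 ?scaler0 ?addr0 //; lia.
- rewrite /strings_sum scaler_sumr -big_split; apply: eq_bigr => n _ /=.
  by rewrite scaler_sumr -big_split; apply: eq_bigr => r _; rewrite /= linearP.
rewrite /strings_sum scaler_sumr -big_split; apply: eq_bigr => n _ /=.
by rewrite scaler_sumr -big_split; apply: eq_bigr => r _; rewrite /= g_lin.
Qed.

Lemma lift_rel0 y : lift_rel 0 y -> y = 0.
Proof.
move=> [N [f [lf f0 /esym x0 ->]]];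
  rewrite /strings_sum big_nat big1 // => n /andP[_ nN].
rewrite big_nat big1 // => r /andP[_ rn].
by rewrite (strings_sum_eq0 lf x0 nN) ?lift_base0.
Qed.

Lemma lift_rel_string n r z : (r <= n)%N -> low n z ->
  lift_rel (iter r E z) (g n r z).
Proof.
move=> rn lz; pose f m i := if (m == n) && (i == r) then z else 0.
have sumf (U : nmodType) (h : nat -> nat -> V -> U) : (forall m i, h m i 0 =
  0) ->
    strings_sum n.+1 h f = h n r z.
  move=> h0; rewrite /strings_sum (bigD1_seq n) ?iota_uniq ?mem_index_iota //=.
  rewrite (bigD1_seq r) ?iota_uniq ?mem_index_iota //= {1}/f !eqxx /=.
  rewrite !big1 ?addr0 // => [m mn|i ir];
    last by rewrite /f (negPf ir) andbF h0.
  by rewrite big1 // => i _; rewrite /f (negPf mn) h0.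
exists n.+1, f; split.
- move=> m i; rewrite /f; case: ifP => [/andP[/eqP -> _] //|_].
  exact: (lowest0 rep).
- by move=> m i nm; rewrite /f (_ : m == n = false) //; lia.
- by rewrite sumf // => m i; rewrite linear0.
by rewrite sumf //; apply: lift_base0.
Qed.

(** The graph [lift_rel] is total because strings span V, and single-valued because it is a linear
    relation whose fibre over 0 is 0. *)
Lemma sl2_lift : exists s : V -> W, linear s /\
  forall n r z, (r <= n)%N -> low n z -> s (iter r E z) = g n r z.
Proof.
have total x : exists y, lift_rel x y.
  move: x; apply: sl2_string_gen => [|a x y [x' xx'] [y' yy']|n r z rn lz].
  - exists 0, 0%N, (fun _ _ => 0); rewrite /strings_sum !big_geq //;
    split=> // n r.
    exact: (lowest0 rep).
  - by exists (a *: x' + y'); apply: lift_relP.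
  by exists (g n r z); apply: lift_rel_string.
have fun_rel x y y' : lift_rel x y -> lift_rel x y' -> y = y'.
  move=> xy xy'; have := lift_relP (-1) xy' xy.
  rewrite !scaleN1r addNr => /lift_rel0 /eqP.
  by rewrite addrC subr_eq0 => /eqP.
exists (fun x => projT1 (cid (total x))); split=> [a x y|n r z rn lz].
  case: cid => w /= ww; case: cid => wx /= wxx; case: cid => wy /= wyy.
  exact: fun_rel ww (lift_relP a wxx wyy).
by case: cid => w /= ww; apply: fun_rel ww (lift_rel_string rn lz).
Qed.

End Lift.

End Sl2Lift.
(** * Graded algebras *)

Section Grading.
Variables (A : algType kk) (G : Zgrading A).

Lemma homZ d a x : G d x -> G d (a *: x).
Proof. by move=> Gx; rewrite -[_ *: _]addr0; apply: homP Gx (hom0 G d). Qed.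

Lemma homB d x y : G d x -> G d y -> G d (x - y).
Proof. by move=> Gx Gy; rewrite addrC -scaleN1r; apply: homP. Qed.

(** One finite list of degrees covers both supports, so identities between the sums can be checked
    term by term. *)
Lemma hcomp_supp2 x y : exists s : seq int, forall phi : int -> A,
  (forall d, hcomp G x d = 0 -> hcomp G y d = 0 -> phi d = 0) ->
  \sum_(d \in [set: int]) phi d = \sum_(d <- s) phi d.
Proof.
pose f d := if hcomp G x d == 0 then hcomp G y d else hcomp G x d.
have [|s sP] := @fsum_seq A f.
  have [fx _ _] := hcompP G x; have [fy _ _] := hcompP G y.
  apply: (sub_finite_set (B := [set d | hcomp G x d != 0] `|` [set d | hcomp G
    y d != 0])).
    by move=> d; rewrite /f /=; case: ifPn; [right|left].
  by rewrite finite_setU.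
exists s => phi phi0; apply: sP => d; rewrite /f; case: eqP => [xd yd|//].
exact: phi0.
Qed.

Lemma hcompD a x y d : hcomp G (a *: x + y) d = a *: hcomp G x d + hcomp G y d.
Proof.
have [fx hx xE] := hcompP G x; have [fy hy yE] := hcompP G y.
suff -> : hcomp G (a *: x + y) = fun d => a *: hcomp G x d + hcomp G y d by [].
apply: hcomp_unique => [|e|]; last 2 [exact: homP].
- apply: (sub_finite_set (B := [set d | hcomp G x d != 0] `|` [set d | hcomp G
  y d != 0])).
    move=> e /=; have [->|] := eqVneq (hcomp G x e) 0; last by left.
    by rewrite scaler0 add0r; right.
  by rewrite finite_setU.
have [s sP] := hcomp_supp2 x y.
rewrite {1}xE {1}yE sP // sP // sP => [|e -> ->]; last by rewrite scaler0 addr0.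
by rewrite big_split scaler_sumr.
Qed.

Lemma hcomp_hom e y : G e y -> hcomp G y = fun d => if d == e then y else 0.
Proof.
move=> Gy; apply: hcomp_unique.
- apply: (sub_finite_set (B := [set e])) => // d /=.
  by case: (d =P e) => // _; rewrite eqxx.
- by move=> d; case: eqP => [->//|_]; apply: hom0.
rewrite (@fsbigTE _ _ _ _ [fset e]%fset) ?big_seq_fset1 ?eqxx // => d.
by rewrite inE => /negPf ->.
Qed.

Definition graded_op (phi : int -> A -> A) (x : A) : A :=
  \sum_(d \in [set: int]) phi d (hcomp G x d).

Lemma graded_op_linear phi : (forall d, linear (phi d)) ->
  linear (graded_op phi).
Proof.
move=> lin a x y; rewrite /graded_op.
have phi0 d : phi d 0 = 0.
  have := lin d 1 0 0; rewrite !scale1r addr0 -{1}[phi d 0]addr0.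
  by move=> /addrI.
have [s sP] := hcomp_supp2 x y.
rewrite sP => [|d hx hy]; last by rewrite hcompD hx hy scaler0 addr0.
rewrite sP => [|d -> //]; rewrite sP => [|d _ -> //].
by rewrite scaler_sumr -big_split; apply: eq_bigr => d _; rewrite hcompD lin.
Qed.

Lemma graded_op_hom phi e y : (forall d, linear (phi d)) -> G e y ->
  graded_op phi y = phi e y.
Proof.
move=> lin Gy; rewrite /graded_op (hcomp_hom Gy).
have phi0 d : phi d 0 = 0.
  have := lin d 1 0 0; rewrite !scale1r addr0 -{1}[phi d 0]addr0.
  by move=> /addrI.
rewrite (@fsbigTE _ _ _ _ [fset e]%fset) ?big_seq_fset1 ?eqxx // => d.
by rewrite inE => /negPf ->.
Qed.

Lemma graded_ind (Q : A -> Prop) : Q 0 ->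
    (forall a x y, Q x -> Q y -> Q (a *: x + y)) ->
  forall x, (forall d, Q (hcomp G x d)) -> Q x.
Proof.
move=> Q0 QP x Qx; have [_ _ ->] := hcompP G x.
have [s sP] := hcomp_seq G x; rewrite sP //.
apply: (big_ind Q) => // y z Qy Qz; rewrite -[y]scale1r; exact: QP.
Qed.

Lemma hom_indep N (f : nat -> A) : (forall n, G (- n%:Z) (f n)) ->
  \sum_(0 <= n < N) f n = 0 -> forall n, (n < N)%N -> f n = 0.
Proof.
move=> Gf sum0 n nN.
have hc0 d : hcomp G 0 d = 0 by rewrite (hcomp_hom (hom0 G 0)); case: ifP.
have hcS (s : seq nat) d : hcomp G (\sum_(m <- s) f m) d =
  \sum_(m <- s) hcomp G (f m) d.
  elim: s => [|m s IH]; rewrite ?big_nil ?hc0 // !big_cons -IH.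
  by rewrite -{1}[f m]scale1r hcompD scale1r.
have := hc0 (- n%:Z); rewrite -sum0 hcS (bigD1_seq n) ?iota_uniq
  ?mem_index_iota //=.
rewrite (hcomp_hom (Gf n)) eqxx big1 ?addr0 // => m mn.
by rewrite (hcomp_hom (Gf m)) ifN //; apply: contraNneq mn; lia.
Qed.

End Grading.

(* For t = v^{1/2} and t = v^{-1/2}, [raise t 0] is E_+ and E_- respectively. *)
Section RaisingOperators.
Variables (A : algType kk) (G : Zgrading A) (E : A).

(** The factor t^2 - t^-2 is v - v^-1 for t = v^{1/2} and its negative for t = v^{-1/2}; this
    absorbs the opposite signs of E_+ and E_-. *)
Definition raise_deg (t : kk) (b : nat) (d : int) (x : A) : A :=
  - (t ^+ 2 - t ^- 2)^-1 *:
    (t ^ (d - 2 *+ b) *: (E * x) - t ^ (2 *+ b - d) *: (x * E)).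

Lemma raise_deg_linear t b d : linear (raise_deg t b d).
Proof.
move=> a x y; rewrite /raise_deg mulrDr mulrDl -scalerAr -scalerAl.
rewrite scalerA [a * _]mulrC -scalerA -scalerDr; congr (_ *: _).
by rewrite scalerBr !scalerDr !scalerA opprD addrACA ![a * _]mulrC.
Qed.

Definition raise (t : kk) (b : nat) : A -> A := graded_op G (raise_deg t b).

HB.instance Definition _ t b := GRing.isLinear.Build kk A A *:%R (raise t b)
  (graded_op_linear G (raise_deg_linear t b)).

Lemma raise_hom t b d x : G d x -> raise t b x = raise_deg t b d x.
Proof. by apply: graded_op_hom; apply: raise_deg_linear. Qed.

End RaisingOperators.

Lemma qz_inv (K : fieldType) (q : K) d : qz q^-1 d = qz q d.
Proof. by rewrite /qz !exprz_inv opprK invrK -opprB -[q^-1 - q]opprB invrN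
  mulrNN. Qed.

(** * Twisted derivations and the kernels of powers of F_- *)

Section TopLeibniz.
Variables (A : algType kk) (G : Zgrading A) (t : kk) (F : {linear A -> A}).
Hypothesis t_vhalf : t = vhalf \/ t = vhalf^-1.
Hypothesis Fdeg : forall d x, G d x -> G (d - 2) (F x).
Hypothesis FM : twisted_derivation G t F.

Lemma t_neq0 : t != 0.
Proof. by case: t_vhalf => ->; rewrite ?invr_eq0 vhalf_neq0. Qed.

Lemma qz_tsqr d : qz (t ^+ 2) d = qz v d.
Proof. by case: t_vhalf => -> //; rewrite exprVn qz_inv. Qed.

Lemma tsqrz d : (t ^+ 2) ^ d = t ^ (d + d).
Proof. by rewrite expfzDr ?t_neq0 // -expfzMl. Qed.

(** Every term of F^n (x y) is a multiple of F^a x F^b y with a + b = n, and n >= i + j - 1 forces a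
    >= i or b >= j. *)
Lemma leibniz_vanish n i j d e x y : G d x -> G e y ->
  iter i F x = 0 -> iter j F y = 0 -> (i + j <= n.+1)%N -> iter n F (x * y) = 0.
Proof.
elim: n i j d e x y => [|n IH] [|i] [|j] d e x y Gx Gy Fx Fy ijn;
  rewrite ?linear0 //.
- by rewrite (Fx : x = 0) mul0r.
- by rewrite (Fx : x = 0) mul0r.
- by rewrite (Fy : y = 0) mulr0.
- lia.
- by rewrite (Fx : x = 0) mul0r linear0.
- by rewrite (Fx : x = 0) mul0r linear0.
- by rewrite (Fy : y = 0) mulr0 linear0.
rewrite iterSr (FM Gx Gy) linearD !linearZ /=.
have Fx' : iter i F (F x) = 0 by rewrite -iterSr.
have Fy' : iter j F (F y) = 0 by rewrite -iterSr.
rewrite (IH i j.+1 _ _ _ _ (Fdeg Gx) Gy Fx' Fy); last lia.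
by rewrite (IH i.+1 j _ _ _ _ Gx (Fdeg Gy) Fx Fy') ?scaler0 ?addr0 //; lia.
Qed.

(** Only the term F^i x F^j y survives, with a quantum binomial coefficient whose denominator is
    moved to the left; the induction is the Pascal rule for quantum binomials. *)
Lemma leibniz_top i j d e x y : G d x -> G e y ->
  iter i.+1 F x = 0 -> iter j.+1 F y = 0 ->
  (qfact i * qfact j) *: iter (i + j) F (x * y) =
  (qfact (i + j) * t ^ (i%:Z * e - j%:Z * d)) *: (iter i F x * iter j F y).
Proof.
have [n] := ubnP (i + j); elim: n i j d e x y =>
  [//|n IH] i j d e x y ijn Gx Gy Fx Fy.
case: i j ijn Fx Fy => [|i] [|j] ijn Fx Fy.
- by rewrite addn0 !qfact0 !mul0r subr0 expr0z.
- have := IH 0%N j d _ x _ _ Gx (Fdeg Gy) Fx; rewrite -!iterSr => /(_ _ Fy) IHj.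
  rewrite add0n iterSr (FM Gx Gy) (Fx : F x = 0) mul0r scaler0 add0r linearZ /=.
  rewrite qfactS [_ *: (_ *: _)]scalerA.
  rewrite (_ : _ * t ^ (- d) = qv j.+1 * t ^ (- d) * (qfact 0 * qfact j));
    last by rewrite qfact0; ring.
  rewrite -scalerA -[j in iter j]add0n IHj; last lia.
  rewrite scalerA add0n !mul0r !sub0r; congr (_ *: _).
  rewrite (_ : - (j.+1%:Z * d) = - d + - (j%:Z * d)); last lia.
  by rewrite expfzDr ?t_neq0 //; ring.
- have := IH i 0%N _ e _ y _ (Fdeg Gx) Gy _ Fy;
  rewrite -!iterSr => /(_ _ Fx) IHi.
  rewrite addn0 iterSr (FM Gx Gy) (Fy : F y = 0) mulr0 scaler0 addr0 linearZ /=.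
  rewrite qfactS [_ *: (_ *: _)]scalerA.
  rewrite (_ : _ * t ^ e = qv i.+1 * t ^ e * (qfact i * qfact 0));
    last by rewrite qfact0; ring.
  rewrite -scalerA -[i in iter i]addn0 IHi; last lia.
  rewrite scalerA addn0 !mul0r !subr0; congr (_ *: _).
  rewrite (_ : i.+1%:Z * e = e + i%:Z * e); last lia.
  by rewrite expfzDr ?t_neq0 //; ring.
have := IH i j.+1 _ e _ y _ (Fdeg Gx) Gy _ Fy;
  rewrite -!iterSr => /(_ _ Fx) IHi.
have := IH i.+1 j d _ x _ _ Gx (Fdeg Gy) Fx; rewrite -!iterSr => /(_ _ Fy) IHj.
rewrite [(i.+1 + _)%N]addSn iterSr (FM Gx Gy) linearD !linearZ /= scalerDr.
rewrite !scalerA.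
rewrite (_ : _ * t ^ e = qv i.+1 * t ^ e * (qfact i * qfact j.+1));
  last by rewrite qfactS; ring.
rewrite (_ : _ * t ^ (- d) = qv j.+1 * t ^ (- d) * (qfact i.+1 * qfact j));
  last first.
  by rewrite (qfactS j); ring.
rewrite -!(scalerA (_ * t ^ _)) IHi; last lia.
rewrite [in iter (i + j.+1)]addnS -addSn IHj; last lia.
rewrite !scalerA -scalerDl addSnnS; congr (_ *: _).
rewrite qfactS.
set Q := qfact _; set u := t ^ (i.+1%:Z * e - j.+1%:Z * d).
(* Relative to the target power u, the two branches carry t^{2(j+1)} [i+1] and t^{-2(i+1)} [j+1]; by
   [qzD] for t^2 these add up to [i+j+2]. *)
have te : t ^ e * t ^ (i%:Z * e - j.+1%:Z * (d - 2)) = u * (t ^+ 2) ^ j.+1%:Z.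
  by rewrite tsqrz /u -!expfzDr ?t_neq0 //; congr (_ ^ _); lia.
have td : t ^ (- d) * t ^ (i.+1%:Z * (e - 2) - j%:Z * d) =
  u * (t ^+ 2) ^ (- i.+1%:Z).
  by rewrite tsqrz /u -!expfzDr ?t_neq0 //; congr (_ ^ _); lia.
rewrite (_ : (i + j.+1).+1%:Z = i.+1%:Z + j.+1%:Z); last lia.
rewrite -[qv (_ + _)]qz_tsqr qzD ?expf_neq0 ?t_neq0 // !qz_tsqr.
have -> : qv i.+1 * t ^ e * (Q * t ^ (i%:Z * e - j.+1%:Z * (d - 2))) =
          qv i.+1 * Q * (t ^ e * t ^ (i%:Z * e - j.+1%:Z * (d - 2))) by ring.
have -> : qv j.+1 * t ^ (- d) * (Q * t ^ (i.+1%:Z * (e - 2) - j%:Z * d)) =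
          qv j.+1 * Q * (t ^ (- d) * t ^ (i.+1%:Z * (e - 2) - j%:Z * d)) by
            ring.
rewrite te td; ring.
Qed.

End TopLeibniz.

(* The half-decorations (v^{1/2}, F_+, F_-) and (v^{-1/2}, F_-, F_+), which lets
   each statement about A_+ be reused for A_-. *)
Record twisted_pair (A : algType kk) (G : Zgrading A) (t : kk) (E : A)
    (F1 F2 : {linear A -> A}) : Prop := TwistedPair {
  tp_vhalf : t = vhalf \/ t = vhalf^-1;
  tp_Edeg : G 2 E;
  tp_F1deg : forall d x, G d x -> G (d - 2) (F1 x);
  tp_F2deg : forall d x, G d x -> G (d - 2) (F2 x);
  tp_F1M : twisted_derivation G t F1;
  tp_F2M : twisted_derivation G t^-1 F2;
  tp_F1E : F1 E = 1;
  tp_F2E : F2 E = 1;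
  tp_comm : forall x, F1 (F2 x) = F2 (F1 x);
  tp_nil1 : forall d x, G d x -> F2 x = 0 ->
    exists n, iter n (raise G E t 0) x = 0;
  tp_nil2 : forall d x, G d x -> F1 x = 0 ->
    exists n, iter n (raise G E t^-1 0) x = 0 }.

Lemma twisted_pair_sym (A : algType kk) (G : Zgrading A) (t : kk) (E : A)
    (F1 F2 : {linear A -> A}) :
  twisted_pair G t E F1 F2 -> twisted_pair G t^-1 E F2 F1.
Proof.
case=> th *; split; rewrite ?invrK //.
by case: th => ->; rewrite ?invrK; [right|left].
Qed.

Section TwistedPair.
Variables (A : algType kk) (G : Zgrading A) (t : kk) (E : A).
Variables (F1 F2 : {linear A -> A}).
Hypothesis tp : twisted_pair G t E F1 F2.

Local Notation R := (raise G E t).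
Let th := tp_vhalf tp.
Let t0 : t != 0 := t_neq0 th.
Let tpS := twisted_pair_sym tp.
Let t'h := tp_vhalf tpS.

Lemma raise_deg2 b d x : G d x -> G (d + 2) (R b x).
Proof.
move=> Gx; rewrite (raise_hom _ _ _ Gx); apply: homZ; apply: homB; apply: homZ.
  by rewrite addrC; apply: homM => //; apply: tp_Edeg tp.
by apply: homM => //; apply: tp_Edeg tp.
Qed.

(** The product rule with F1 E = 1 gives x the factors t^{d+b} and t^{-(d+b)}. The shift by b in
    [raise_deg] turns them into t^{2d} and t^{-2d}, so the commutator sees the weight d although x
    has degree d + b. *)
Lemma F1_raise b d x : G (d + b%:Z) x -> F1 (R b x) = R b (F1 x) - qv d *: x.
Proof.
move=> Gx; rewrite (raise_hom _ _ _ Gx) (raise_hom _ _ _ (tp_F1deg tp Gx)).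
rewrite /raise_deg linearZ (linearB F1) !(linearZ_LR F1) /=.
rewrite (tp_F1M tp (tp_Edeg tp) Gx) (tp_F1M tp Gx (tp_Edeg tp)) (tp_F1E tp).
rewrite mul1r mulr1.
set X := E * F1 x; set Y := F1 x * E; set s := - _^-1.
have scal (a1 a2 a3 b1 b2 b3 c : kk) : a1 * a2 = a3 -> b1 * b2 = b3 ->
    s * (a1 * c - b1 * c^-1) = - qv d ->
    s *: (a1 *: (c *: x + a2 *: X) - b1 *: (b2 *: Y + c^-1 *: x)) =
    s *: (a3 *: X - b3 *: Y) - qv d *: x.
  move=> <- <- e; rewrite -(scaleNr (qv d)) -e !scalerDr !scalerN !scalerDr
    !scalerA.
  rewrite !opprD mulrBr scalerBl !mulrA !addrA.
  by congr (_ - _); rewrite -addrA addrC.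
rewrite -(invr_expz t (d + b)); apply: scal.
- by rewrite -expfzDr //; congr (t ^ _); lia.
- by rewrite -expfzDr //; congr (t ^ _); lia.
rewrite invr_expz -!expfzDr //.
rewrite (_ : _ + (d + b) = d + d); last lia.
rewrite (_ : _ + (- (d + b)) = - d + - d); last lia.
rewrite -!(tsqrz th) /s mulNr mulrC; congr (- _).
by rewrite -(qz_tsqr th) /qz.
Qed.

(** The twist of F2 is inverse to that of the raising operator, so the two multiples of x coming
    from F2 E = 1 cancel. *)
Lemma F2_raise0 x d : G d x -> F2 x = 0 -> F2 (R 0 x) = 0.
Proof.
move=> Gx Fx; rewrite (raise_hom _ _ _ Gx) /raise_deg linearZ (linearB F2)
  !(linearZ_LR F2) /=.
rewrite (tp_F2M tp (tp_Edeg tp) Gx) (tp_F2M tp Gx (tp_Edeg tp)) (tp_F2E tp) Fx.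
rewrite mul1r mulr1 mulr0 mul0r !scaler0 !addr0 !add0r !scalerA !exprz_inv
  opprK.
by rewrite -!expfzDr // addrN addNr subrr scaler0.
Qed.

Lemma hom_expE m : G (2 *+ m) (E ^+ m).
Proof.
elim: m => [|m IH]; first exact: hom1.
by rewrite exprS (_ : 2 *+ m.+1 = 2 + 2 *+ m);
  [apply: homM (tp_Edeg tp) IH|lia].
Qed.

(** Since F2 E = 1 and F2^2 E = 0, each further factor E raises the order of vanishing by one, and
    the top term of the q-Leibniz formula is a nonzero multiple of x. *)
Lemma F2_mulE m d x : G d x -> F2 x = 0 -> exists c, [/\ c != 0,
  iter m F2 (x * E ^+ m) = c *: x & iter m.+1 F2 (x * E ^+ m) = 0].
Proof.
move=> Gx Fx; elim: m => [|m [c [c0 Fm Fm1]]].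
  by exists 1; rewrite oner_neq0 expr0 mulr1 scale1r.
have GxE : G (d + 2 *+ m) (x * E ^+ m) by apply: homM (hom_expE m).
have FE : iter 2 F2 E = 0.
  by rewrite /= (tp_F2E tp) (twisted_derivation1 (tp_F2M tp)).
rewrite exprSr mulrA.
have := leibniz_top t'h (tp_F2deg tp) (tp_F2M tp) GxE (tp_Edeg tp) Fm1 FE.
rewrite addn1 Fm /= (tp_F2E tp) mulr1 scalerA; set k := qfact m * _;
  set l := qfact m.+1 * _ * c => top.
have k0 : k != 0 := mulf_neq0 (qfact_neq0 _) (qfact_neq0 _).
have l0 : l != 0.
  exact: (mulf_neq0 (mulf_neq0 (qfact_neq0 _) (expfz_neq0 _ (t_neq0 t'h))) c0).
clearbody k l; exists (k^-1 * l); split.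
- by apply: mulf_neq0 l0; rewrite invr_eq0.
- by rewrite -scalerA -top scalerA (mulVf k0) scale1r.
by apply: (leibniz_vanish (n := m.+2) (tp_F2deg tp) (tp_F2M tp) GxE (tp_Edeg
  tp) Fm1 FE); lia.
Qed.

(* By division by powers of E, ker F2^m is the sum of the (ker F2) E^j, j < m. *)
Lemma kerF2_ind (Q : A -> Prop) m d : Q 0 ->
    (forall a x y, Q x -> Q y -> Q (a *: x + y)) ->
    (forall j x, (j < m)%N -> G (d - 2 *+ j) x -> F2 x = 0 -> Q (x * E ^+ j)) ->
  forall y, G d y -> iter m F2 y = 0 -> Q y.
Proof.
move=> Q0 QP; elim: m => [|m IH] Qg y Gy Fy; first by rewrite (Fy : y = 0).
have Gx : G (d - 2 *+ m) (iter m F2 y).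
  elim: (m) => [|k IHk]; first by rewrite subr0.
  by rewrite (_ : d - _ = d - 2 *+ k - 2); [apply: (tp_F2deg tp)|lia].
have [c [c0 Fc _]] := F2_mulE m Gx Fy.
rewrite -[y](subrK (c^-1 *: (iter m F2 y * E ^+ m))) addrC; apply: QP.
  exact: Qg.
apply: IH => [j x jm||]; first by apply: Qg; lia.
  apply: homB => //; apply: homZ; rewrite -[d in G d _](subrK (2 *+ m)).
  exact: homM (hom_expE m).
by rewrite linearB linearZ /= Fc scalerA (mulVf c0) scale1r subrr.
Qed.

(** As E commutes with E^j, the twisted commutator with x E^j differs from that with x only in its
    scalars, and the discrepancy is a multiple of x E^{j+1}. At j = b the scalars agree; this is
    what confines the operator to ker F2^{b+1}. *)
Lemma raise_mulE b j d x : G d x -> exists c1 c2, [/\ (j = b -> c2 = 0) &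
  R b (x * E ^+ j) = c1 *: (R 0 x * E ^+ j) + c2 *: (x * E ^+ j.+1)].
Proof.
move=> Gx; pose s := - (t ^+ 2 - t ^- 2)^-1.
have GxE : G (d + 2 *+ j) (x * E ^+ j) by apply: homM (hom_expE j).
exists (t ^ (2 *+ j - 2 *+ b)),
  (s * (t ^ (2 *+ j - 2 *+ b - d) - t ^ (2 *+ b - 2 *+ j - d))); split.
  by move=> ->; rewrite subrr mulr0.
rewrite (raise_hom _ _ _ GxE) (raise_hom _ _ _ Gx) /raise_deg -/s.
rewrite -scalerAl mulrBl -!scalerAl scalerA [_ * s]mulrC -!scalerA -scalerDr.
congr (s *: _); rewrite scalerBr !scalerA -!expfzDr // exprSr !mulrA scalerBl.
rewrite -(mulrA x E) -exprS exprSr mulrA.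
rewrite addrA subr0 sub0r.
rewrite (_ : d + 2 *+ j - 2 *+ b = 2 *+ j - 2 *+ b + d); last lia.
rewrite (_ : 2 *+ b - (d + 2 *+ j) = 2 *+ b - 2 *+ j - d); last lia.
by rewrite subrK.
Qed.

(* The weight is the degree minus b. *)
Definition kerF2_wt b (d : int) (x : A) : Prop :=
  G (d + b%:Z) x /\ iter b.+1 F2 x = 0.

(** On (ker F2) E^j with j <= b, [raise_mulE] produces terms in (ker F2) E^j and, only for j < b, in
    (ker F2) E^{j+1}; all of them are killed by F2^{b+1}. *)
Lemma iterF2_raise b d x : kerF2_wt b d x -> iter b.+1 F2 (R b x) = 0.
Proof.
case=> Gx Fx; move: x Gx Fx.
apply: (@kerF2_ind (fun x => iter b.+1 F2 (R b x) =
  0)) => [|a x y Qx Qy|j x jb Gx Fx].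
- by rewrite !linear0.
- by rewrite linearP iter_is_linear Qx Qy scaler0 addr0.
have [c1 [c2 [c20 ->]]] := raise_mulE b j Gx.
have [_ [_ _ F1j]] := F2_mulE j (raise_deg2 0 Gx) (F2_raise0 Gx Fx).
have [_ [_ _ F2j]] := F2_mulE j.+1 Gx Fx.
rewrite iter_is_linear (iter_le0 _ F1j) // scaler0 add0r iterZ.
have [/c20 ->|jb'] := eqVneq j b; first by rewrite scale0r.
by rewrite (iter_le0 _ F2j) ?scaler0 //; lia.
Qed.

Lemma raise_nil b d x : kerF2_wt b d x -> exists n, iter n (R b) x = 0.
Proof.
case=> Gx Fx; move: x Gx Fx.
apply: (@kerF2_ind (fun x => exists n, iter n (R b) x = 0)).
- by exists 0%N.
- move=> a x y [n xn] [m ym]; exists (maxn n m); rewrite iter_is_linear.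
  by rewrite (iter_le0 _ xn) ?(iter_le0 _ ym) ?scaler0 ?addr0 //; lia.
move=> j x jb Gx Fx; have [n xn] := tp_nil1 tp Gx Fx.
(* Each application of [R b] either lowers the nilpotency order m of the left factor or raises the
   exponent i of E, which cannot pass b; so m + (b - i) bounds the number of steps. *)
suff th' k i m e y : (m + (b - i) <= k)%N -> (i <= b)%N -> G e y ->
    iter m (R 0) y = 0 -> iter k (R b) (y * E ^+ i) = 0.
  by exists (n + (b - j))%N; apply: (th' _ j n _ x) Gx xn; lia.
elim: k i m e y => [|k IH] i [|m] e y mk ib Gy Ry;
  rewrite ?(Ry : y = 0) ?mul0r ?linear0 //.
rewrite iterSr; have [c1 [c2 [c20 ->]]] := raise_mulE b i Gy.
have Ry' : iter m (R 0) (R 0 y) = 0 by rewrite -iterSr.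
rewrite iter_is_linear (IH i m _ _ _ ib (raise_deg2 0 Gy) Ry'); last lia.
rewrite scaler0 add0r iterZ.
have [/c20 ->|ib'] := eqVneq i b; first by rewrite scale0r.
by rewrite (IH i.+1 m.+1 _ _ _ _ Gy) ?scaler0 //; lia.
Qed.

Lemma kerF2_rep b : sl2_weights (kerF2_wt b) (R b) F1.
Proof.
split.
- by move=> d; split; [apply: hom0|rewrite linear0].
- move=> d a x y [Gx Fx] [Gy Fy]; split; first exact: homP.
  by rewrite iter_is_linear Fx Fy scaler0 addr0.
- move=> d x wx; split; last exact: iterF2_raise wx.
  by rewrite addrAC; apply: raise_deg2; case: wx.
- move=> d x [Gx Fx]; split; first by rewrite addrAC; apply: tp_F1deg tp _ _ Gx.
  suff -> : iter b.+1 F2 (F1 x) = F1 (iter b.+1 F2 x) by rewrite Fx linear0.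
  by elim: b.+1 => //= n ->; rewrite (tp_comm tp).
- by move=> d x [Gx _]; apply: F1_raise.
exact: raise_nil.
Qed.

End TwistedPair.

(** * Linked pairs *)

Section RaiseComm.
Variables (A : algType kk) (G : Zgrading A) (t : kk) (E : A).
Hypothesis GE : G 2 E.

(** Left and right multiplication by E commute, hence so do twisted commutators with fixed scalars.
    The increments of b and c compensate for the degree 2 gained from the inner operator and keep
    the scalars fixed. *)
Lemma raise_comm b c y :
  raise G E t b.+1 (raise G E t^-1 c y) = raise G E t^-1 c.+1 (raise G E t b y).
Proof.
have bracket_comm (a1 a2 b1 b2 : kk) x :
    a1 *: (E * (b1 *: (E * x) - b2 *: (x * E))) -
      a2 *: ((b1 *: (E * x) - b2 *: (x * E)) * E) =
    b1 *: (E * (a1 *: (E * x) - a2 *: (x * E))) -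
      b2 *: ((a1 *: (E * x) - a2 *: (x * E)) * E).
  rewrite !mulrBr !mulrBl -!scalerAr -!scalerAl !scalerBr !scalerA !mulrA.
  rewrite ![b1 * _]mulrC ![b2 * _]mulrC !opprB !addrA.
  by rewrite addrAC [RHS]addrAC; congr (_ + _); rewrite addrAC.
have rdeg s k d x : G d x -> G (d + 2) (raise G E s k x).
  move=> Gx; rewrite (raise_hom _ _ _ Gx); apply: homZ; apply: homB;
    apply: homZ.
    by rewrite addrC; apply: homM.
  exact: homM.
apply: (@graded_ind _ G (fun y => raise G E t b.+1 (raise G E t^-1 c y) =
                                  raise G E t^-1 c.+1 (raise G E t b y))).
- by rewrite !linear0.
- have lin s k u x x' : raise G E s k (u *: x + x') =
      u *: raise G E s k x + raise G E s k x' by exact: linearP.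
  by move=> a x x' ex ex'; rewrite !lin ex ex'.
move=> d; have [_ /(_ d)] := hcompP G y; move: (hcomp G y d) => {}y Gy _.
rewrite (raise_hom _ _ _ (rdeg _ _ _ _ Gy)) (raise_hom _ _ _ Gy).
rewrite (raise_hom _ _ _ (rdeg _ _ _ _ Gy)) (raise_hom _ _ _ Gy).
rewrite /raise_deg -!scalerAr -!scalerAl.
set s := - _^-1; set s' := - _^-1.
have out (r a1 a2 : kk) u w : a1 *: (r *: u) - a2 *: (r *: w) =
  r *: (a1 *: u - a2 *: w).
  by rewrite !scalerA ![_ * r]mulrC -!scalerA -scalerBr.
rewrite !out !scalerA [s' * s]mulrC; congr (_ *: _).
rewrite (_ : d + 2 - 2 *+ b.+1 = d - 2 *+ b); last lia.
rewrite (_ : d + 2 - 2 *+ c.+1 = d - 2 *+ c); last lia.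
rewrite (_ : 2 *+ b.+1 - (d + 2) = 2 *+ b - d); last lia.
rewrite (_ : 2 *+ c.+1 - (d + 2) = 2 *+ c - d); last lia.
exact: bracket_comm.
Qed.

Lemma iter_raise_comm p q b c y :
  iter p (raise G E t (b + q)) (iter q (raise G E t^-1 c) y) =
  iter q (raise G E t^-1 (c + p)) (iter p (raise G E t b) y).
Proof.
have step r k x : iter p (raise G E t r.+1) (raise G E t^-1 k x) =
    raise G E t^-1 (k + p) (iter p (raise G E t r) x).
  by elim: p => [|p IH]; rewrite ?addn0 //= IH raise_comm addnS.
elim: q => [|q IH]; first by rewrite addn0.
by rewrite addnS iterS step IH.
Qed.

End RaiseComm.

Definition linked (A : algType kk) (G : Zgrading A) (F1 F2 : A -> A)
    (p q : nat) (u w : A) : Prop :=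
  exists Y, [/\ G (p%:Z + q%:Z) Y, iter p.+1 F1 Y = 0, iter q.+1 F2 Y = 0,
    iter p F1 Y = qfact p *: u & iter q F2 Y = qfact q *: w].

Section Linked.
Variables (A : algType kk) (G : Zgrading A) (t : kk) (E : A).
Variables (F1 F2 : {linear A -> A}).
Hypothesis tp : twisted_pair G t E F1 F2.

Local Notation link := (linked G F1 F2).
Let th := tp_vhalf tp.
Let t0 : t != 0 := t_neq0 th.
Let tpS := twisted_pair_sym tp.

Lemma linkP p q a u w u' w' : link p q u w -> link p q u' w' ->
  link p q (a *: u + u') (a *: w + w').
Proof.
move=> [Y [GY F1Y F2Y uE wE]] [Y' [GY' F1Y' F2Y' uE' wE']].
exists (a *: Y + Y'); split; first exact: homP.
- by rewrite iter_is_linear F1Y F1Y' scaler0 addr0.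
- by rewrite iter_is_linear F2Y F2Y' scaler0 addr0.
- by rewrite iter_is_linear uE uE' scalerDr !scalerA [a * _]mulrC.
by rewrite iter_is_linear wE wE' scalerDr !scalerA [a * _]mulrC.
Qed.

Lemma link0 p q : link p q 0 0.
Proof. by exists 0; split; rewrite ?linear0 //; apply: hom0. Qed.

Lemma link_mul p q p' q' u w u' w' : link p q u w -> link p' q' u' w' ->
  link (p + p') (q + q') (u * u') (w * w').
Proof.
move=> [Y [GY F1Y F2Y uE wE]] [Y' [GY' F1Y' F2Y' uE' wE']].
have top1 := leibniz_top th (tp_F1deg tp) (tp_F1M tp) GY GY' F1Y F1Y'.
have top2 := leibniz_top (tp_vhalf tpS) (tp_F2deg tp) (tp_F2M tp) GY GY' F2Y
  F2Y'.
(* The twist is t^k in the formula for F1 and (t^-1)^{-k} in the formula for F2, so rescaling Y Y'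
   by t^{-k} corrects both. *)
pose k := p%:Z * q'%:Z - p'%:Z * q%:Z.
have k1 : p%:Z * (p'%:Z + q'%:Z) - p'%:Z * (p%:Z + q%:Z) = k by rewrite /k;
  ring.
have k2 : q%:Z * (p'%:Z + q'%:Z) - q'%:Z * (p%:Z + q%:Z) = - k by rewrite /k;
  ring.
have fact2 m n : qfact m * qfact n != 0 := mulf_neq0 (qfact_neq0 m) (qfact_neq0
  n).
have {}top1 : iter (p + p') F1 (Y * Y') = (qfact (p + p') * t ^ k) *: (u * u').
  apply: (scalerI_eq (fact2 p p')); rewrite top1 k1 uE uE' -scalerAl -scalerAr.
  by rewrite !scalerA; congr (_ *: _); ring.
have {}top2 : iter (q + q') F2 (Y * Y') = (qfact (q + q') * t ^ k) *: (w * w').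
  apply: (scalerI_eq (fact2 q q')); rewrite top2 k2 wE wE' -scalerAl -scalerAr.
  by rewrite exprz_inv opprK !scalerA; congr (_ *: _); ring.
have tk (c : kk) : t ^ (- k) * (c * t ^ k) = c.
  by rewrite mulrCA -(expfzDr _ _ t0) addNr expr0z mulr1.
exists (t ^ (- k) *: (Y * Y')); split; rewrite ?iterZ.
- apply: homZ; rewrite (_ : _ + _ = p%:Z + q%:Z + (p'%:Z + q'%:Z)); last lia.
  exact: homM.
- rewrite (leibniz_vanish (tp_F1deg tp) (tp_F1M tp) GY GY' F1Y F1Y') ?scaler0
  //.
  by rewrite addSn addnS.
- rewrite (leibniz_vanish (tp_F2deg tp) (tp_F2M tp) GY GY' F2Y F2Y') ?scaler0
  //.
  by rewrite addSn addnS.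
- by rewrite top1 scalerA tk.
by rewrite top2 scalerA tk.
Qed.

(** The element E links 1 to 1 in bidegree (1, 1). *)
Lemma link_succ p q u w : link p q u w -> link p.+1 q.+1 u w.
Proof.
move=> uw; rewrite -[u]mulr1 -[w]mulr1 -addn1 -(addn1 q); apply: link_mul => //.
have F11 := twisted_derivation1 (tp_F1M tp).
have F21 := twisted_derivation1 (tp_F2M tp).
have q1 : qfact 1 = 1 by rewrite qfactS qfact0 mulr1 (qz1 v_sub_neq0).
exists E; split; first exact: tp_Edeg tp.
- by rewrite /= (tp_F1E tp).
- by rewrite /= (tp_F2E tp).
- by rewrite /= (tp_F1E tp) q1 scale1r.
by rewrite /= (tp_F2E tp) q1 scale1r.
Qed.

Lemma link_add p q k u w : link p q u w -> link (p + k) (q + k) u w.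
Proof.
by move=> uw; elim: k => [|k IH]; rewrite ?addn0 // !addnS; apply: link_succ.
Qed.

(* Y has weight p and is killed by F1^p in the sl2-module ker F2^(q+1). *)
Lemma link_inj p q w : link p q 0 w -> w = 0.
Proof.
move=> [Y [GY _ F2Y]]; rewrite scaler0 => F1Y wE.
have Y0 : Y = 0 by apply: (sl2_inj (kerF2_rep tp q) (d := p) _ F1Y).
by apply: (scalerI_eq (qfact_neq0 q)); rewrite -wE Y0 linear0 scaler0.
Qed.

(** Supplies the hypotheses of [tau_linked] for a product of linked elements. *)
Lemma link_degl p q u w : link p q u w ->
  [/\ G (q%:Z - p%:Z) u, F1 u = 0 & iter q.+1 F2 u = 0].
Proof.
move=> [Y [GY F1Y F2Y uE _]].
have -> : u = (qfact p)^-1 *: iter p F1 Y.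
  by rewrite uE scalerA (mulVf (qfact_neq0 p)) scale1r.
split.
- apply: homZ; have wY : kerF2_wt G F2 q p Y by [].
  have [] := wt_iterF (kerF2_rep tp q) p wY.
  by rewrite (_ : _ + _ = q%:Z - p%:Z) //; lia.
- by rewrite linearZ /= -iterS F1Y scaler0.
by rewrite iterZ (iter_comm _ _ _ (fun x =>
  esym (tp_comm tp x))) F2Y linear0 scaler0.
Qed.
End Linked.

Section LinkString.
Variables (A : algType kk) (G : Zgrading A) (t : kk) (E : A).
Variables (F1 F2 : {linear A -> A}).

(** The vector y is killed by F1 and by F2^{q+1}, so it is a lowest weight vector of weight -p in
    the sl2-module ker F2^{q+1}, and Y is the top of its string. *)
Lemma kerF2_string (tp : twisted_pair G t E F1 F2) p q z :
  G (- (p + q)%N%:Z) z -> F1 z = 0 -> F2 z = 0 ->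
  let y := iter q (raise G E t^-1 0) z in
  let Y := iter p (raise G E t q) y in
  [/\ G (p%:Z + q%:Z) Y, iter p.+1 F1 Y = 0 & iter p F1 Y =
    (qfact p * qfact p) *: y].
Proof.
move=> Gz F1z F2z y Y; have repS := kerF2_rep (twisted_pair_sym tp) 0.
have lz : lowest (kerF2_wt G F1 0) F2 (p + q) z.
  by do 2 split => //; rewrite addr0.
have [Gy F1y] : kerF2_wt G F1 0 (2 *+ q - (p + q)%N%:Z) y.
  exact: (wt_string repS q lz).
have ly : lowest (kerF2_wt G F2 q) F1 p y.
  split; last exact: F1y.
  split; last exact: (iterF_string0 repS lz).
  by move: Gy; rewrite (_ : _ + _ = - p%:Z + q%:Z) //; lia.
have rep := kerF2_rep tp q; split.
- have [GY _] := wt_string rep p ly; move: GY.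
  by rewrite (_ : _ + _ = p%:Z + q%:Z) //; lia.
- exact: (iterF_string0 rep ly).
by rewrite (iterF_string_full rep ly) // subnn qfact0 divr1.
Qed.

End LinkString.

(** Because the raising operators commute, the same Y is the top of a string over E_-^q z for F1 and
    over E_+^p z for F2; [kerF2_string] is applied once to each ordering. Dividing Y by [p]!
    normalises the first component. *)
Lemma link_string (A : algType kk) (G : Zgrading A) (t : kk) (E : A)
    (F1 F2 : {linear A -> A}) p q z :
  twisted_pair G t E F1 F2 -> G (- (p + q)%N%:Z) z -> F1 z = 0 -> F2 z = 0 ->
  linked G F1 F2 p q (iter q (raise G E t^-1 0) z)
    ((qfact q / qfact p) *: iter p (raise G E t 0) z).
Proof.
move=> tp Gz F1z F2z; have [GY F1Y F1p] := kerF2_string tp Gz F1z F2z.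
have Gz' : G (- (q + p)%N%:Z) z by rewrite addnC.
have [_] := kerF2_string (twisted_pair_sym tp) Gz' F2z F1z.
rewrite invrK.
have comm := iter_raise_comm t (tp_Edeg tp) p q 0 0 z.
rewrite !add0n in comm; rewrite -comm.
move: GY F1Y F1p; set Y := iter p _ _ => GY F1Y F1p F2Y F2q.
exists ((qfact p)^-1 *: Y); split.
- exact: homZ.
- by rewrite iterZ F1Y scaler0.
- by rewrite iterZ F2Y scaler0.
- by rewrite iterZ F1p scalerA mulrA (mulVf (qfact_neq0 p)) mul1r.
by rewrite iterZ F2q !scalerA; congr (_ *: _); ring.
Qed.

(** * Maps between sl2-modules *)

(** Here the weight vectors span V, and weight spaces are independent in weights -n, the weights of
    the vectors in [lowest]. *)
Record sl2_module (V : lmodType kk) (P : int -> V -> Prop)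
    (E F : {linear V -> V}) : Prop := Sl2Module {
  sl2_rep : sl2_weights P E F;
  sl2_Fnil : locally_nilpotent F;
  sl2_gen : forall Q : V -> Prop, Q 0 ->
    (forall a x y, Q x -> Q y -> Q (a *: x + y)) ->
    (forall d x, P d x -> Q x) -> forall x, Q x;
  sl2_indep : forall N (f : nat -> V), (forall n, P (- n%:Z) (f n)) ->
    \sum_(0 <= n < N) f n = 0 -> forall n, (n < N)%N -> f n = 0 }.

Section LinearFunctions.
Variables (V W : lmodType kk) (f : V -> W).
Hypothesis f_lin : linear f.

Lemma lin_fun0 : f 0 = 0.
Proof. by have := f_lin (-1) 0 0; rewrite scaler0 addr0 scaleN1r addNr. Qed.

Lemma lin_funZ a x : f (a *: x) = a *: f x.
Proof. by have := f_lin a x 0; rewrite lin_fun0 !addr0. Qed.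

End LinearFunctions.

Section Sl2Module.
Variables (V : lmodType kk) (P : int -> V -> Prop) (E F : {linear V -> V}).
Hypothesis modV : sl2_module P E F.
Local Notation low := (lowest P F).

Lemma sl2_module_ind (Q : V -> Prop) :
    Q 0 -> (forall a x y, Q x -> Q y -> Q (a *: x + y)) ->
    (forall n r z, (r <= n)%N -> low n z -> Q (iter r E z)) ->
  forall x, Q x.
Proof. case: modV => rep Fnil gen _; exact: (sl2_string_gen rep Fnil gen). Qed.

Lemma sl2_module_lift (W : lmodType kk) (g : nat -> nat -> V -> W) :
    (forall n r a x y, low n x -> low n y ->
       g n r (a *: x + y) = a *: g n r x + g n r y) ->
  exists s : V -> W, linear s /\
    forall n r z, (r <= n)%N -> low n z -> s (iter r E z) = g n r z.
Proof. case: modV => rep Fnil gen ind; exact: (sl2_lift rep Fnil gen ind). Qed.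

Lemma sl2_lin_eq (W : lmodType kk) (f g : V -> W) : linear f -> linear g ->
    (forall n r z, (r <= n)%N -> low n z -> f (iter r E z) = g (iter r E z)) ->
  f =1 g.
Proof.
move=> fl gl fg; apply: sl2_module_ind => //; first by rewrite !lin_fun0.
by move=> a x y ex ey; rewrite fl gl ex ey.
Qed.

Lemma sl2_lin_eq_wt (W : lmodType kk) (f g : V -> W) : linear f -> linear g ->
    (forall d x, P d x -> f x = g x) -> f =1 g.
Proof.
move=> fl gl fg; apply: (sl2_gen modV) => //; first by rewrite !lin_fun0.
by move=> a x y ex ey; rewrite fl gl ex ey.
Qed.

Lemma sl2_flip : exists h : V -> V, [/\ linear h /\ involutive h,
  forall x, h (E x) = F (h x), forall x, h (F x) = E (h x),
  forall d x, P d x -> P (- d) (h x) &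
  forall n z, low n z -> h z = divpow E n z].
Proof.
have rep := sl2_rep modV.
(* In divided powers this prescribes E^{(r)} z to be sent to E^{(n-r)} z. *)
have [|h [hl hE]] := sl2_module_lift
    (g := fun n r z => (qfact r / qfact (n - r)) *: iter (n - r) E z).
  by move=> n r a x y _ _; rewrite iter_is_linear scalerDr !scalerA [a *
    _]mulrC.
have cl (f g : V -> V) : linear f -> linear g -> linear (f \o g).
  by move=> fl gl a x y; rewrite /= gl fl.
have El : linear E by move=> a x y; rewrite linearP.
have Fl : linear F by move=> a x y; rewrite linearP.
have hh : involutive h.
  move=> x; apply: (@sl2_lin_eq _ (h \o h) id) => [||n r z rn lz];
    [exact: cl|by []|].
  rewrite /= (hE n) // (lin_funZ hl) (hE n) ?leq_subr // scalerA subKn //.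
  suff -> : qfact r / qfact (n - r) * (qfact (n - r) / qfact r) =
    1 by rewrite scale1r.
  by rewrite mulrA (mulfVK (qfact_neq0 _)) (mulfV (qfact_neq0 _)).
have hEF x : h (E x) = F (h x).
  apply: (@sl2_lin_eq _ (h \o E) (F \o h)) => [||n r z rn lz]; try exact: cl.
  rewrite /= -iterS (hE n r) //; have [rn'|nr] := ltnP r n.
    rewrite (hE n) // (linearZ_LR F) /=.
    rewrite (_ : (n - r)%N = (n - r.+1).+1); last lia.
    rewrite (F_string rep _ lz) scalerA; congr (_ *: _).
    rewrite (_ : n%:Z - _ = r.+1%:Z); last lia.
    rewrite !qfactS; apply/esym/cancel_middle.
    exact: qv_neq0.
  (* At the end of the string both sides vanish: E^{n+1} z = 0, and h sends E^n z to a multiple of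
     z, which F kills. *)
  rewrite (_ : r = n); last lia.
  rewrite (iterE_string0 rep lz) (lin_fun0 hl) subnn /=.
  by case: lz => _ Fz; rewrite linearZ /= Fz scaler0.
exists h; split=> // [x|d x Px|n z lz].
- by rewrite -{1}[x]hh -hEF hh.
- have [m Fx] := sl2_Fnil modV x.
  move: x Px Fx; apply: (sl2_string_ind rep (Q := fun x => P (- d) (h x))).
  + by rewrite (lin_fun0 hl); apply: wt0 rep _.
  + by move=> a x y Px Py; rewrite hl; apply: (wtP rep).
  + move=> n r z _ rn <- lz; rewrite (hE n) //; apply: (wtZ rep).
    have := wt_string rep (n - r) lz; congr P; lia.
by rewrite -[z in h z]/(iter 0 E z) (hE n) // subn0 qfact0 div1r.
Qed.

End Sl2Module.

Section Sl2Iso.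
Variables (V : lmodType kk) (P : int -> V -> Prop) (E F : {linear V -> V}).
Variables (W : lmodType kk) (P' : int -> W -> Prop) (E' F' : {linear W -> W}).
Hypotheses (modV : sl2_module P E F) (modW : sl2_module P' E' F').
Variables (phi : V -> W) (psi : W -> V).
Hypotheses (low_phi : forall n z, lowest P F n z -> lowest P' F' n (phi z))
  (low_psi : forall n z, lowest P' F' n z -> lowest P F n (psi z)).
Hypotheses (phi_lin : forall n a x y, lowest P F n x -> lowest P F n y ->
    phi (a *: x + y) = a *: phi x + phi y)
  (psi_lin : forall n a x y, lowest P' F' n x -> lowest P' F' n y ->
    psi (a *: x + y) = a *: psi x + psi y).
Hypotheses (phiK : forall n z, lowest P F n z -> psi (phi z) = z)
  (psiK : forall n z, lowest P' F' n z -> phi (psi z) = z).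

Lemma sl2_iso : exists s : V -> W, [/\ linear s /\ bijective s,
  forall x, s (E x) = E' (s x), forall x, s (F x) = F' (s x),
  forall d x, P d x -> P' d (s x) & forall n z, lowest P F n z -> s z = phi z].
Proof.
have rep := sl2_rep modV; have rep' := sl2_rep modW.
have [|s [sl sE]] := sl2_module_lift modV (g := fun n r z => iter r E' (phi z)).
  by move=> n r a x y lx ly; rewrite (phi_lin _ lx ly) iter_is_linear.
have [|s' [sl' sE']] := sl2_module_lift modW (g := fun n r z =>
  iter r E (psi z)).
  by move=> n r a x y lx ly; rewrite (psi_lin _ lx ly) iter_is_linear.
have cl (U1 U2 U3 : lmodType kk) (f : U2 -> U3) (g : U1 -> U2) :
    linear f -> linear g -> linear (f \o g).
  by move=> fl gl a x y; rewrite /= gl fl.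
have El (U : lmodType kk) (f : {linear U -> U}) : linear f.
  by move=> a x y; rewrite linearP.
exists s; split.
- split=> //; exists s' => x.
    apply: (@sl2_lin_eq _ _ _ _ modV _ (s' \o s) id) => [||n r z rn lz];
      [exact: cl|by []|].
    by rewrite /= (sE n) // (sE' n) ?(phiK lz) //; apply: low_phi.
  apply: (@sl2_lin_eq _ _ _ _ modW _ (s \o s') id) => [||n r z rn lz];
    [exact: cl|by []|].
  by rewrite /= (sE' n) // (sE n) ?(psiK lz) //; apply: low_psi.
- apply: (@sl2_lin_eq _ _ _ _ modV _ (s \o E) (E' \o s)) => [||n r z rn lz];
  try exact: cl.
  rewrite /= (sE n r) // -!iterS; have [rn'|nr] := ltnP r n;
    first by rewrite (sE n).
  rewrite (_ : r = n); last lia.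
  by rewrite (iterE_string0 rep lz) (iterE_string0 rep' (low_phi lz)) lin_fun0.
- apply: (@sl2_lin_eq _ _ _ _ modV _ (s \o F) (F' \o s)) => [||n r z rn lz];
  try exact: cl.
  rewrite /= (sE n r) //; case: r rn => [|r] rn.
    by case: (low_phi lz) => _ ->; case: lz => _ ->; rewrite lin_fun0.
  rewrite (F_string rep _ lz) (F_string rep' _ (low_phi lz)) (lin_funZ sl).
  by rewrite (sE n) //; apply: ltnW.
- move=> d x Px; have [m Fx] := sl2_Fnil modV x.
  move: x Px Fx; apply: (sl2_string_ind rep (Q := fun x => P' d (s x))).
  + by rewrite (lin_fun0 sl); apply: wt0 rep' _.
  + by move=> a x y Px Py; rewrite sl; apply: (wtP rep').
  + by move=> n r z _ rn <- lz; rewrite (sE n) //;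
    apply: (wt_string rep' _ (low_phi lz)).
by move=> n z lz; rewrite -[z in s z]/(iter 0 E z) (sE n).
Qed.

End Sl2Iso.

Section KernelModule.
Variables (A : algType kk) (G : Zgrading A) (t : kk) (E : A).
Variables (F1 F2 : {linear A -> A}).
Hypotheses (tp : twisted_pair G t E F1 F2) (F1nil : locally_nilpotent F1).
Variables (V : lmodType kk) (emb : {linear V -> A}) (EV FV : {linear V -> V}).
Hypotheses (emb_inj : injective emb) (emb_ker : forall x, F2 (emb x) = 0)
  (emb_surj : forall x, F2 x = 0 -> exists y, emb y = x)
  (emb_E : forall x, emb (EV x) = raise G E t 0 (emb x))
  (emb_F : forall x, emb (FV x) = F1 (emb x)).

Lemma emb_iterE n x : emb (iter n EV x) = iter n (raise G E t 0) (emb x).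
Proof. by elim: n => //= n <-. Qed.

Lemma emb_iterF n x : emb (iter n FV x) = iter n F1 (emb x).
Proof. by elim: n => //= n <-. Qed.

(** Through [emb] the space V is ker F2 as a type of its own, so that A_+ and A_- are both
    instances. It is spanned by weight vectors because the kernel of a homogeneous operator contains
    the homogeneous components of its elements. *)
Lemma kernel_module : sl2_module (fun d x => G d (emb x)) EV FV.
Proof.
split.
- split.
  + by move=> d; rewrite linear0; apply: hom0.
  + by move=> d a x y Gx Gy; rewrite linearP; apply: homP.
  + by move=> d x Gx; rewrite emb_E; apply: (raise_deg2 tp).
  + by move=> d x Gx; rewrite emb_F; apply: (tp_F1deg tp).
  + move=> d x Gx; apply: emb_inj;
    rewrite linearB linearZ /= emb_F !emb_E emb_F.
    by apply: (F1_raise tp); rewrite addr0.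
  move=> d x Gx; have [n xn] := tp_nil1 tp Gx (emb_ker x).
  by exists n; apply: emb_inj; rewrite emb_iterE xn linear0.
- by move=> x; have [n xn] := F1nil (emb x); exists n; apply: emb_inj;
     rewrite emb_iterF xn linear0.
- move=> Q Q0 QP Qg x.
  suff [y [/emb_inj <- //]] : exists y, emb y = emb x /\ Q y.
  apply: (@graded_ind _ G (fun a => exists y, emb y = a /\ Q y)).
  + by exists 0; rewrite linear0.
  + move=> a u w [y [<- Qy]] [y' [<- Qy']]; exists (a *: y + y').
    by rewrite linearP; split=> //; apply: QP.
  + move=> d; have := hcomp_ker (tp_F2deg tp) (emb_ker x) d.
    move=> /emb_surj [y ey]; exists y; split=> //; apply: (Qg d).
    by rewrite ey; case: (hcompP G (emb x)).
move=> N f Gf sum0 n nN; apply: emb_inj; rewrite linear0.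
apply: (hom_indep (N := N) Gf) => //.
by rewrite -linear_sum sum0 linear0.
Qed.

End KernelModule.

(** * Decorated algebras *)

Section Decorated.
Variables (A : algType kk) (D : decoration A).
Local Notation G := (dgr D).

Lemma raise0E t x : raise G (dE D) t 0 x =
  - (t ^+ 2 - t ^- 2)^-1 *: twisted_commE D t x.
Proof.
rewrite /raise /graded_op /twisted_commE; have [s sP] := hcomp_seq G x.
rewrite sP => [|d ->]; last by rewrite /raise_deg mulr0 mul0r !scaler0 subrr
  scaler0.
rewrite sP => [|d ->]; last by rewrite mulr0 mul0r !scaler0 subrr.
by rewrite scaler_sumr; apply: eq_bigr => d _; rewrite /raise_deg subr0 sub0r.
Qed.

Lemma dEpE x : dEp D x = raise G (dE D) vhalf 0 x.
Proof. by rewrite raise0E scaleNr. Qed.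

Lemma dEmE x : dEm D x = raise G (dE D) vhalf^-1 0 x.
Proof.
rewrite raise0E exprVn invrK -/v -opprB -/angle1.
by rewrite invrN opprK.
Qed.

Lemma Kpow_hom t d x : G d x -> Kpow D t x = t ^ d *: x.
Proof.
apply: (@graded_op_hom _ G (fun d x => t ^ d *: x)) => e a u w.
by rewrite scalerDr !scalerA mulrC.
Qed.

Lemma Kpow_linear t : linear (Kpow D t).
Proof.
apply: (@graded_op_linear _ G (fun d x => t ^ d *: x)) => e a u w.
by rewrite scalerDr !scalerA mulrC.
Qed.

Local Notation pval := (val : Aplus D -> A).
Local Notation mval := (val : Aminus D -> A).

Lemma Eplus_linear : linear (@Eplus A D).
Proof. by move=> a x y; apply: val_inj; rewrite linearP /= !dEpE linearP. Qed.
HB.instance Definition _ := GRing.isLinear.Build kk (Aplus D) (Aplus D) *:%R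
  (@Eplus A D) Eplus_linear.

Lemma Fplus_linear : linear (@Fplus A D).
Proof. by move=> a x y; apply: val_inj; rewrite linearP /= linearP. Qed.
HB.instance Definition _ := GRing.isLinear.Build kk (Aplus D) (Aplus D) *:%R
  (@Fplus A D) Fplus_linear.

Lemma Eminus_linear : linear (@Eminus A D).
Proof. by move=> a x y; apply: val_inj; rewrite linearP /= !dEmE linearP. Qed.
HB.instance Definition _ := GRing.isLinear.Build kk (Aminus D) (Aminus D) *:%R
  (@Eminus A D) Eminus_linear.

Lemma Fminus_linear : linear (@Fminus A D).
Proof. by move=> a x y; apply: val_inj; rewrite linearP /= linearP. Qed.
HB.instance Definition _ := GRing.isLinear.Build kk (Aminus D) (Aminus D) *:%R
  (@Fminus A D) Fminus_linear.

Lemma minus_val_Fp (x : Aminus D) : dFp D (val x) = 0.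
Proof. by case: x => x xP; apply/eqP. Qed.

Lemma plus_val_Fm (x : Aplus D) : dFm D (val x) = 0.
Proof. by case: x => x xP; apply/eqP. Qed.

Lemma Kplus_linear : linear (@Kplus A D).
Proof. by move=> a x y; apply: val_inj; rewrite linearP /= /dK Kpow_linear. Qed.

Lemma Kinvplus_linear : linear (@Kinvplus A D).
Proof. by move=> a x y; apply: val_inj;
  rewrite linearP /= /dKinv Kpow_linear. Qed.

Lemma Kminus_linear : linear (@Kminus A D).
Proof. by move=> a x y; apply: val_inj; rewrite linearP /= /dK Kpow_linear. Qed.

Hypotheses (hEp : locally_nilpotent (@Eplus A D))
  (hEm : locally_nilpotent (@Eminus A D)).

Lemma decorated_pair : twisted_pair G vhalf (dE D) (dFp D) (dFm D).
Proof.
split.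
- by left.
- exact: dE_deg.
- exact: dFp_deg.
- exact: dFm_deg.
- exact: dFpM.
- exact: dFmM.
- exact: dFpE.
- exact: dFmE.
- exact: dF_comm.
- move=> d x _ /eqP Fx; pose y : Aplus D := MkAplus Fx.
  have [n yn] := hEp y; exists n; have := congr1 pval yn; rewrite linear0 => <-.
  by elim: n {yn} => //= n ->; rewrite dEpE.
move=> d x _ /eqP Fx; pose y : Aminus D := MkAminus Fx.
have [n yn] := hEm y; exists n; have := congr1 mval yn; rewrite linear0 => <-.
by elim: n {yn} => //= n ->; rewrite dEmE.
Qed.

Lemma plus_module : sl2_module (fun d (x : Aplus D) =>
  G d (val x)) (@Eplus A D) (@Fplus A D).
Proof.
apply: (kernel_module decorated_pair) => //.
- exact: dFp_nil.
- exact: plus_val_Fm.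
- by move=> x /eqP Fx; exists (MkAplus Fx).
by move=> x; rewrite /= dEpE.
Qed.

Lemma minus_module : sl2_module (fun d (x : Aminus D) =>
  G d (val x)) (@Eminus A D) (@Fminus A D).
Proof.
apply: (kernel_module (twisted_pair_sym decorated_pair)) => //.
- exact: dFm_nil.
- exact: minus_val_Fp.
- by move=> x /eqP Fx; exists (MkAminus Fx).
by move=> x; rewrite /= dEmE.
Qed.

(** * Existence of sigma_- and eta_+, and bijectivity of tau *)

Local Notation low_plus := (lowest (fun d (x : Aplus D) =>
  G d (val x)) (@Fplus A D)).
Local Notation low_minus := (lowest (fun d (x : Aminus D) =>
  G d (val x)) (@Fminus A D)).

Lemma low_plusE n x : low_plus n x <-> G (- n%:Z) (val x) /\ dFp D (val x) = 0.
Proof.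
split=> [[Gx Fx]|[Gx Fx]]; split=> //; last exact: val_inj.
by have := congr1 val Fx.
Qed.

Lemma low_minusE n x : low_minus n x <-> G (- n%:Z) (val x) /\ dFm D (val x) =
  0.
Proof.
split=> [[Gx Fx]|[Gx Fx]]; split=> //; last exact: val_inj.
by have := congr1 val Fx.
Qed.

Lemma exists_sigma_minus : exists s, @is_sigma_minus A D s.
Proof.
(* On A_0 these maps are the identity of A; elsewhere they take the default value 0. They are
   evaluated at lowest weight vectors, which lie in A_0. *)
pose phi (x : Aminus D) : Aplus D := insubd 0 (val x).
pose psi (x : Aplus D) : Aminus D := insubd 0 (val x).
have val_phi n z : low_minus n z -> val (phi z) = val z.
  by move=> /low_minusE[_ Fz]; rewrite insubdK // inE Fz.
have val_psi n z : low_plus n z -> val (psi z) = val z.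
  by move=> /low_plusE[_ Fz]; rewrite insubdK // inE Fz.
have low_phi n z : low_minus n z -> low_plus n (phi z).
  move=> lz; apply/low_plusE; rewrite (val_phi _ _ lz) minus_val_Fp.
  by case: lz.
have low_psi n z : low_plus n z -> low_minus n (psi z).
  move=> lz; apply/low_minusE; rewrite (val_psi _ _ lz) plus_val_Fm.
  by case: lz.
have repM := sl2_rep minus_module; have repP := sl2_rep plus_module.
have [|||| s [[sl sb] sE sF sP sphi]] :=
    sl2_iso minus_module plus_module low_phi low_psi.
- move=> n a x y lx ly; apply: val_inj.
  rewrite (val_phi _ _ (lowestP repM a lx ly)) !linearP /=.
  by rewrite (val_phi _ _ lx) (val_phi _ _ ly).
- move=> n a x y lx ly; apply: val_inj.
  rewrite (val_psi _ _ (lowestP repP a lx ly)) !linearP /=.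
  by rewrite (val_psi _ _ lx) (val_psi _ _ ly).
- by move=> n z lz; apply: val_inj;
  rewrite (val_psi _ _ (low_phi _ _ lz)) (val_phi _ _ lz).
- by move=> n z lz; apply: val_inj;
  rewrite (val_phi _ _ (low_psi _ _ lz)) (val_psi _ _ lz).
exists s; split=> // [x|x [Fpx Fmx]].
  apply: (@sl2_lin_eq_wt _ _ _ _ minus_module _ (s \o @Kminus A D) (@Kplus A D
    \o s)).
  - by move=> a u w; rewrite /= Kminus_linear sl.
  - by move=> a u w; rewrite /= sl Kplus_linear.
  move=> d u Gu /=; rewrite (_ : Kminus u = v ^ d *: u); last first.
    by apply: val_inj; rewrite linearZ /= /dK (Kpow_hom _ Gu).
  by rewrite (lin_funZ sl); apply: val_inj;
    rewrite linearZ /= /dK (Kpow_hom _ (sP _ _ Gu)).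
(* The last clause concerns arbitrary elements of A_0, so it is reduced to homogeneous components,
   which again lie in A_0. *)
suff [y [/val_inj <- //]] : exists y : Aminus D, val y = val x /\ val (s y) =
  val y.
apply: (@graded_ind _ G (fun a => exists y : Aminus D, val y =
  a /\ val (s y) = val y)).
- by exists 0; rewrite (lin_fun0 sl) !linear0.
- move=> a u w [y [<- ey]] [y' [<- ey']]; exists (a *: y + y').
  by rewrite sl !linearP /= ey ey'.
move=> d; have Fp0 := hcomp_ker (@dFp_deg _ D) Fpx d.
have Fm0 := hcomp_ker (@dFm_deg _ D) Fmx d.
have [_ /(_ d) Gd _] := hcompP G (val x).
move: Fp0 => /eqP Fp0; exists (MkAminus Fp0); split=> //.
set y := MkAminus Fp0; have Gy : G d (val y) by [].
have Fy : Fminus y = 0 by apply: val_inj.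
(* A component of positive degree is killed by F_- and hence is 0 by [sl2_inj]; the others are
   lowest weight vectors. *)
have [d1|d0] := leP 1%:Z d.
  by rewrite (sl2_inj repM (m := 1) Gy Fy d1) (lin_fun0 sl) !linear0.
have ly : low_minus `|d| y by split=> //; rewrite (_ : - _ = d) //; lia.
by rewrite (sphi _ _ ly) (val_phi _ _ ly).
Qed.

Lemma exists_eta_plus : exists h, @is_eta_plus A D h.
Proof.
have [h [[hl hh] hE hF hP hlow]] := sl2_flip plus_module.
exists h; split=> // [x|n x [Fpx _] Gx].
  apply: (@sl2_lin_eq_wt _ _ _ _ plus_module _ (h \o @Kplus A D) (@Kinvplus A D
    \o h)).
  - by move=> a u w; rewrite /= Kplus_linear hl.
  - by move=> a u w; rewrite /= hl Kinvplus_linear.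
  move=> d u Gu /=; rewrite (_ : Kplus u = v ^ d *: u); last first.
    by apply: val_inj; rewrite linearZ /= /dK (Kpow_hom _ Gu).
  rewrite (lin_funZ hl); apply: val_inj; rewrite linearZ /= /dKinv.
  by rewrite (Kpow_hom _ (hP _ _ Gu)) exprz_inv opprK.
by apply: hlow; apply/low_plusE.
Qed.

Lemma sigma_minusP : is_sigma_minus (@sigma_minus A D).
Proof. exact: (xgetPex _ exists_sigma_minus). Qed.

Lemma eta_plusP : is_eta_plus (@eta_plus A D).
Proof. exact: (xgetPex _ exists_eta_plus). Qed.

Lemma tau_linear : linear (@tau A D).
Proof.
have [[sl _] _ _ _ _] := sigma_minusP; have [[hl _] _ _ _ _] := eta_plusP.
by move=> a x y; rewrite /tau /= sl hl.
Qed.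

Lemma tau_bijective : bijective (@tau A D).
Proof.
have [[_ sb] _ _ _ _] := sigma_minusP; have [[_ hh] _ _ _ _] := eta_plusP.
exact: bij_comp (inv_bij hh) sb.
Qed.

(** * Values of tau on strings, and multiplicativity *)

Lemma val_iter_Eminus r (z : Aminus D) : val (iter r (@Eminus A D) z) =
  iter r (raise G (dE D) vhalf^-1 0) (val z).
Proof. by elim: r => //= r <-; rewrite dEmE. Qed.

Lemma val_iter_Eplus r z : val (iter r (@Eplus A D) z) =
  iter r (raise G (dE D) vhalf 0) (val z).
Proof. by elim: r => //= r <-; rewrite dEpE. Qed.

(** Here sigma_- turns E_-^r z into E_+^r z, and eta_+ turns this into F_+^r E_+^{(n)} z, which
    [iterF_string] evaluates. In divided powers, E_-^{(r)} z goes to E_+^{(n-r)} z. *)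
Lemma tau_string n r z : (r <= n)%N -> low_minus n z ->
  val (tau (iter r (@Eminus A D) z)) =
  (qfact r / qfact (n - r)) *: iter (n - r) (raise G (dE D) vhalf 0) (val z).
Proof.
move=> rn lz; have [_ sE _ _ sA] := sigma_minusP;
  have [[hl _] hE _ _ hA] := eta_plusP.
have A0z : A0 D (val z) by split; [apply: minus_val_Fp|case/low_minusE: lz].
set w := sigma_minus z; have wz : val w = val z by apply: sA.
have lw : low_plus n w.
  by apply/low_plusE; rewrite wz minus_val_Fp; case: lz.
have -> : tau (iter r (@Eminus A D) z) = iter r (@Fplus A D) (eta_plus w).
  rewrite /tau /=; transitivity (eta_plus (iter r (@Eplus A D) w)).
    by congr eta_plus; elim: (r) => //= k <-; rewrite sE.
  by elim: (r) => //= k <-; rewrite hE.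
rewrite (hA n) ?wz //; last by case: lz.
rewrite /divpow -/(qfact n).
have := iterF_string (sl2_rep plus_module) (p := n - r) (r := r) lw.
rewrite subnK // subKn // subnn qfact0 mulr1 leqnn => /(_ isT) str.
have {}str : iter r (@Fplus A D) ((qfact n)^-1 *: iter n (@Eplus A D) w) =
    (qfact r / qfact (n - r)) *: iter (n - r) (@Eplus A D) w.
  rewrite (iterZ (@Fplus A D)).
  apply: (scalerI_eq (mulf_neq0 (qfact_neq0 n) (qfact_neq0 (n - r)))).
  rewrite [LHS]scalerA mulrAC (mulfV (qfact_neq0 n)) mul1r str scalerA.
  by congr (_ *: _); rewrite mulrACA (mulfV (qfact_neq0 (n - r))) mulr1.
by rewrite str linearZ /= val_iter_Eplus wz.
Qed.

Local Notation link := (linked G (dFp D) (dFm D)).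

(** Such an x is a combination of vectors E_-^r z with r <= q. By [link_string] and [tau_string]
    each is linked to its image in bidegree (n-r, r), and [link_add] shifts this by q - r; the
    degree condition makes the result (p, q). *)
Lemma tau_linked p q (x : Aminus D) : G (q%:Z - p%:Z) (val x) ->
  iter q.+1 (dFm D) (val x) = 0 ->
  link p q (val x) (val (tau x)).
Proof.
move=> Gx Fx; have {}Fx : iter q.+1 (@Fminus A D) x = 0.
  apply: val_inj; rewrite linear0 -Fx.
  by elim: q.+1 => //= k ->.
move: x Gx Fx; apply: (sl2_string_ind (sl2_rep minus_module)
  (Q := fun x => link p q (val x) (val (tau x)))).
- by rewrite (lin_fun0 tau_linear) !linear0; apply: link0.
- by move=> a x y lx ly; rewrite tau_linear !linearP; apply: linkP.
move=> n r z rq rn deg lz; rewrite val_iter_Eminus (tau_string rn lz).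
have Gz : G (- (n - r + r)%N%:Z) (val z) by rewrite subnK //; case: lz.
have Fmz : dFm D (val z) = 0 by case/low_minusE: lz.
have := link_add decorated_pair (q - r)
  (link_string decorated_pair Gz (minus_val_Fp z) Fmz).
rewrite (_ : (n - r + (q - r))%N = p); last lia.
by rewrite (_ : (r + (q - r))%N = q) //; lia.
Qed.

(** By bilinearity both factors may be taken on strings. Then tau (x y) and tau x tau y are both
    linked to x y in the same bidegree, so they coincide. *)
Lemma tau_mul (x y : Aminus D) : tau (x * y) = tau x * tau y.
Proof.
move: x y; apply: (sl2_module_ind minus_module) =>
  [y|a x x' ex ex' y|n r z rn lz y].
- by rewrite mul0r (lin_fun0 tau_linear) mul0r.
- by rewrite mulrDl -scalerAl !tau_linear ex ex' mulrDl -scalerAl.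
move: y; apply: (sl2_module_ind minus_module) =>
  [|a y y' ey ey'|n' r' z' rn' lz'].
- by rewrite mulr0 (lin_fun0 tau_linear) mulr0.
- by rewrite mulrDr -scalerAr !tau_linear ey ey' mulrDr -scalerAr.
have rep := sl2_rep minus_module.
have string_linked m k u : (k <= m)%N -> low_minus m u ->
    link (m - k) k (val (iter k (@Eminus A D) u)) (val (tau (iter k (@Eminus A
      D) u))).
  move=> km lu; apply: tau_linked.
    have := wt_string rep k lu; congr (G _ _); lia.
  have := congr1 val (iterF_string0 rep lu (ltnSn k)); rewrite linear0 => <-.
  by elim: k.+1 => //= i ->.
have lxy := link_mul decorated_pair (string_linked _ _ _ rn lz) (string_linked
  _ _ _ rn' lz').
have [Gxy _ Fxy] := link_degl decorated_pair lxy.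
(* Subtracting the two links leaves one with first component 0, whose second component vanishes by
   [link_inj]. *)
have := linkP (-1) (tau_linked (x := iter r (@Eminus A D) z * iter r' (@Eminus
  A D) z') Gxy Fxy) lxy.
rewrite !scaleN1r addNr => /(link_inj decorated_pair) /eqP.
by rewrite addrC subr_eq0 => /eqP exy; apply: val_inj; rewrite -exy.
Qed.

Lemma tau1 : tau (1 : Aminus D) = 1.
Proof.
have F1 : dFm D 1 = 0 := twisted_derivation1 (@dFmM _ D).
have l1 : low_minus 0 (1 : Aminus D).
  by apply/low_minusE; rewrite oppr0; split=> //; apply: hom1.
apply: val_inj; have := tau_string (leqnn 0) l1.
by rewrite subnn qfact0 divr1 scale1r.
Qed.

End Decorated.

Theorem theorem3p6 (A : algType kk) (D : decoration A)
  (hEp : locally_nilpotent (@Eplus A D))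
  (hEm : locally_nilpotent (@Eminus A D)) :
  algebra_isomorphism (@tau A D).
Proof.
split.
- exact: tau_linear.
- by split; [apply: tau1|apply: tau_mul].
exact: tau_bijective.
Qed.
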